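(* There exists an absolute constant $c>0$ such that for all integers $r\geq 2$ and $k\ge 3$, \[ f(k;r)\leq k^{400k^4}R^{40k^2}\leq 2^{c(k^4\log k+k^3r\log r)}, \] where $R=R(k;r)$ is the $r$-color Ramsey number for $K_k$.
   Context: For graphs $G,F$ and an integer $r\ge 2$, write $G\rightarrow (F)_r$ if every coloring of the edges of $G$ with $r$ colors yields a monochromatic copy (subgraph isomorphic to $F$) of $F$. $R(k;r)$ denotes the smallest $n$ such that $K_n\rightarrow (K_k)_r$. A graph $G$ is $(k;r)$-Folkman if $G\rightarrow (K_k)_r$ and $G$ contains no copy of $K_{k+1}$. The $r$-color Folkman number $f(k;r)$ is the minimum number of vertices of a $(k;r)$-Folkman graph. Here $\log$ denotes the binary logarithm. *)

(* Defs.v *)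
From HB Require Import structures.
From mathcomp Require Import all_boot all_order all_algebra.
From mathcomp Require Import reals exp.

Set Implicit Arguments.
Unset Strict Implicit.
Unset Printing Implicit Defensive.

Import Order.TTheory GRing.Theory Num.Theory.

Record sgraph := SGraph {
  vertex :> finType;
  adj : rel vertex;
  adj_sym : symmetric adj;
  adj_irr : irreflexive adj }.
Arguments SGraph [vertex adj] _ _.

Lemma complete_sym n : symmetric (fun i j : 'I_n => i != j).
Proof. by move=> i j; rewrite eq_sym. Qed.

Lemma complete_irr n : irreflexive (fun i j : 'I_n => i != j).
Proof. by move=> i; rewrite eqxx. Qed.

Definition complete (n : nat) : sgraph :=
  SGraph (@complete_sym n) (@complete_irr n).

(* Not necessarily induced. *)
Definition contains_copy (F G : sgraph) : Prop :=
  exists f : F -> G, injective f /\ forall x y, adj x y -> adj (f x) (f y).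

Section ColorClass.
Variables (G : sgraph) (r : nat).

(* The edge between x and y is the set [set x; y]; a coloring assigns a color
   to every set of vertices, but only its values at edges are ever used. *)
Definition coloring := {set G} -> 'I_r.

Definition class_adj (col : coloring) (a : 'I_r) : rel G :=
  fun x y => adj x y && (col [set x; y] == a).

Lemma class_sym (col : coloring) (a : 'I_r) : symmetric (class_adj col a).
Proof. by move=> x y; rewrite /class_adj adj_sym setUC. Qed.

Lemma class_irr (col : coloring) (a : 'I_r) : irreflexive (class_adj col a).
Proof. by move=> x; rewrite /class_adj adj_irr. Qed.

Definition color_class (col : coloring) (a : 'I_r) : sgraph :=
  SGraph (class_sym col a) (class_irr col a).

End ColorClass.

Definition arrows (G F : sgraph) (r : nat) : Prop :=
  forall col : coloring G r, exists a : 'I_r,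
    contains_copy F (color_class col a).

Definition is_least (P : nat -> Prop) (n : nat) : Prop :=
  P n /\ forall m, P m -> n <= m.

Definition is_ramsey_number (k r : nat) : nat -> Prop :=
  is_least (fun n => arrows (complete n) (complete k) r).

Definition is_folkman (k r : nat) (G : sgraph) : Prop :=
  arrows G (complete k) r /\ ~ contains_copy (complete k.+1) G.

Definition is_folkman_number (k r : nat) : nat -> Prop :=
  is_least (fun n => exists G : sgraph, is_folkman k r G /\ #|vertex G| = n).

Definition log2 (K : realType) (x : K) : K := (ln x / ln 2)%R.

(* Main.v *)
Require Import Defs.
From HB Require Import structures.
From mathcomp Require Import all_boot all_order all_algebra.
From mathcomp Require Import reals exp.
From mathcomp Require Import boolp sequences.
From mathcomp Require Import ring lra zify.

(* Consider the hypergraph whose vertices are the pairs in an n-set and whose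
   edges are the copies of K_k. The container method covers all its independent
   sets by few sets, each with fewer than n^k/(2rR^k) copies of K_k. By the
   definition of R and averaging, r such containers always miss a fraction of
   order 1/R^2 of all pairs, so a random graph with slightly more than
   n^(2-2/(k+1)) edges is not covered by any r of them. At this density it
   has far fewer copies of K_{k+1} than edges, and deleting one edge from each
   copy does not spoil the argument. All constants are of the form
   k^O(k^2) R^O(1), which is what the final bound on n can afford. *)

Set Implicit Arguments.
Unset Strict Implicit.
Unset Printing Implicit Defensive.

Import Order.TTheory GRing.Theory Num.Theory.

(** * Counting maps and copies of cliques *)

(** The shape of the bound comes from a narrow window. More than n^(2-2/(k+1)) edges are needed to
    beat the number of containers, fewer than n^(2-2/(k+2)) to keep K_{k+1} rarer than edges. The
    ratio is only n^(2/((k+1)(k+2))), so absorbing a constant C takes n about C^((k+1)(k+2)/2), and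
    k^O(k^2) R^O(1) becomes k^O(k^4) R^O(k^2). A container theorem losing a power of the inverse
    density R^k would already be too weak. Factors of r are absorbed through r < R, a consequence of
    k >= 3. Since the deleted edges depend on the random tuple, the union bound runs over them as
    well. Probabilities appear as cardinalities of sets of functions. *)

Lemma prod_comp_le (A B T : finType) (g : A -> B) (u : A -> T) : injective g ->
  #|[set f : {ffun B -> T} | [forall a, f (g a) == u a]]| <= #|T| ^ (#|B| - #|A|).
Proof.
move=> gi; pose P b : pred T := fun t => [forall a, (g a == b) ==> (t == u a)].
have -> : #|[set f : {ffun B -> T} | [forall a, f (g a) == u a]]| = #|family P|.
  apply: eq_card => f; rewrite inE; apply/forallP/familyP => [h b|h a].
    by apply/forallP => a; apply/implyP => /eqP<-.
  by have /forallP/(_ a) := h (g a); rewrite eqxx.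
rewrite card_family foldrE big_map big_enum /= (bigID (mem (codom g))) /=.
have -> : #|B| - #|A| = #|[predC codom g]|.
  by rewrite -(card_codom gi) -(cardC (mem (codom g))) addKn.
rewrite -[X in _ <= X]mul1n leq_mul //.
  apply: (@leq_trans (\prod_(b in codom g) 1)); last by rewrite big1.
  apply: leq_prod => b /codomP[a ->]; rewrite -(card1 (u a)); apply: subset_leq_card.
  by apply/subsetP => t /forallP/(_ a); rewrite eqxx.
rewrite -prod_nat_const; apply: leq_prod => b _; exact: max_card.
Qed.

Lemma card_bigcup_le (I T : finType) (P : pred I) (B : I -> {set T}) :
  #|\bigcup_(i | P i) B i| <= \sum_(i | P i) #|B i|.
Proof.
elim/big_rec2: _ => [|i k D _ IH]; first by rewrite cards0.
by apply: leq_trans (leq_card_setU _ _) _; rewrite leq_add2l.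
Qed.

Lemma card_sum_le (I T : finType) (P : pred I) (A : {set T}) (B : I -> {set T}) :
  (forall x, x \in A -> exists2 i, P i & x \in B i) -> #|A| <= \sum_(i | P i) #|B i|.
Proof.
move=> h; apply: leq_trans (card_bigcup_le P B); apply: subset_leq_card.
by apply/subsetP => x /h[i Pi xB]; apply/bigcupP; exists i.
Qed.

(** Choosing a preimage of each element of [U] gives an injection of [U] into [B], on whose image
    [f] is prescribed. *)
Lemma card_image_sup (B T : finType) (U : {set T}) :
  #|[set f : {ffun B -> T} | U \subset f @: setT]| <= #|B| ^ #|U| * #|T| ^ (#|B| - #|U|).
Proof.
apply: (@leq_trans (\sum_(g : {ffun 'I_#|U| -> B} | injectiveb g)
    #|[set f : {ffun B -> T} | [forall a, f (g a) == enum_val a]]|)).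
  apply: card_sum_le => h; rewrite inE => sub.
  have /fin_all_exists[g hg] (a : 'I_#|U|) : exists x, h x = enum_val a.
    by have /imsetP[x _ ->] := subsetP sub _ (enum_valP a); exists x.
  exists (finfun g); last by rewrite inE; apply/forallP => a; rewrite ffunE hg.
  by apply/injectiveP => a b; rewrite !ffunE => e; apply: enum_val_inj; rewrite -!hg e.
apply: (@leq_trans (\sum_(g : {ffun 'I_#|U| -> B} | injectiveb g) #|T| ^ (#|B| - #|U|))).
  apply: leq_sum => g /injectiveP gi; apply: leq_trans (prod_comp_le _ gi) _; by rewrite card_ord.
rewrite sum_nat_const leq_mul2r; apply/orP; right.
by apply: leq_trans (max_card _) _; rewrite card_ffun card_ord.
Qed.

Notation pair_type n := {e : {set 'I_n} | #|e| == 2}.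

Definition pairs n (X : {set 'I_n}) : {set pair_type n} := [set e : pair_type n | val e \subset X].

(** Copies are labelled, so that they compare directly with n^k and compose with maps between
    cliques. *)
Definition copies k n (C : {set pair_type n}) : {set {ffun 'I_k -> 'I_n}} :=
  [set h : {ffun 'I_k -> 'I_n} | injectiveb h && (pairs (h @: setT) \subset C)].

Lemma card_pairs n (X : {set 'I_n}) : #|pairs X| = 'C(#|X|, 2).
Proof.
rewrite -cards_draws -(card_imset _ val_inj); apply: eq_card => e; rewrite inE.
apply/imsetP/andP => [[e' +  ->]|[eX e2]]; first by rewrite inE (valP e').
by exists (Sub e e2 : pair_type n); rewrite ?inE //= ?SubK.
Qed.

Lemma card_pair_type n : #|{: pair_type n}| = 'C(n, 2).
Proof.
have := card_pairs [set: 'I_n]; rewrite cardsT card_ord => <-.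
by apply: eq_card => e; rewrite !inE subsetT.
Qed.

Lemma pairs_subP k n (h : 'I_k -> 'I_n) (C : {set pair_type n}) : injective h ->
  reflect (forall x y, x != y -> [exists e in C, val e == [set h x; h y]])
          (pairs (h @: setT) \subset C).
Proof.
move=> hi; apply: (iffP subsetP) => [sub x y xy|sub e].
  have e2 : #|[set h x; h y]| == 2 by rewrite cards2 (inj_eq hi) xy.
  apply/existsP; exists (Sub [set h x; h y] e2 : pair_type n); rewrite SubK eqxx andbT.
  by apply: sub; rewrite inE SubK subUset !sub1set !imset_f.
rewrite inE => sube; have /cards2P[a [b [ab eab]]] := valP e.
move: sube; rewrite eab subUset !sub1set => /andP[/imsetP[x _ ax] /imsetP[y _ bY]].
have xy : x != y by apply: contraNneq ab => xy; rewrite ax bY xy.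
have /existsP[e' /andP[e'C /eqP e'v]] := sub x y xy.
by rewrite (_ : e = e') //; apply: val_inj; rewrite eab e'v -ax -bY.
Qed.

Lemma card_missing n (U : {set pair_type n}) :
  #|[set p : 'I_n * 'I_n | ~~ [exists e in U, val e == [set p.1; p.2]]]| <= n + 2 * #|~: U|.
Proof.
set BP := [set p | _]; pose D := [set (i, i) | i : 'I_n].
have -> : BP = (BP :&: D) :|: (BP :\: D) by rewrite setID.
apply: leq_trans (leq_card_setU _ _) _; apply: leq_add.
  apply: leq_trans (subset_leq_card (subsetIr _ _)) _.
  by apply: leq_trans (leq_imset_card _ _) _; rewrite card_ord.
have eX : #|setX (~: U) [set: bool]| = #|~: U| * 2 by rewrite cardsX cardsT card_bool.
rewrite mulnC -eX.
(* An off-diagonal ordered pair is recovered from its underlying set and its order bit; [insub]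
   yields [None] on the diagonal only. *)
pose f (p : 'I_n * 'I_n) : option (pair_type n) * bool := (insub [set p.1; p.2], p.1 < p.2).
have fi : {in BP :\: D &, injective f}.
  move=> [a b] [a' b']; rewrite !inE /= => /andP[abD _] /andP[abD' _].
  have ab : a != b by apply: contraNneq abD => ->; apply/imsetP; exists b.
  have ab' : a' != b' by apply: contraNneq abD' => ->; apply/imsetP; exists b'.
  rewrite /f /= !insubT ?cards2 ?ab ?ab' // => _ _ [] /setP eq lt.
  have := eq a; have := eq b; have := eq a'; have := eq b'; rewrite !inE !eqxx !orbT /=.
  move: lt; rewrite -!val_eqE /= in ab ab' *; move=> lt h1 h2 h3 h4.
  by congr (_, _); apply: val_inj => /=; lia.
rewrite -(card_in_imset fi) -(card_imset (setX _ _) (f := fun p => (Some p.1, p.2))); last first.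
  by move=> [? ?] [? ?] [-> ->].
apply: subset_leq_card; apply/subsetP => _ /imsetP[[a b] + ->]; rewrite !inE /= => /andP[abD abU].
have ab : a != b by apply: contraNneq abD => ->; apply/imsetP; exists b.
have e2 : #|[set a; b]| == 2 by rewrite cards2 ab.
apply/imsetP; exists (Sub [set a; b] e2 : pair_type n, a < b); last by rewrite /f /= insubT.
rewrite !inE andbT; apply: contra abU => eU; apply/existsP; exists (Sub [set a;
  b] e2 : pair_type n).
by rewrite eU SubK eqxx.
Qed.

(* Count the maps 'I_R -> 'I_n: most are injective and, if few pairs are missed
   by all C a, avoid the missed pairs, so each of them sends a monochromatic
   k-clique of the coloring pulled back to 'I_R into some C a. *)
Lemma supersaturation k r R n (C : 'I_r -> {set pair_type n}) :
  arrows (complete R) (complete k) r -> 0 < r -> 1 < R -> 4 * R ^ 2 <= n ->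
  (forall a, #|copies k (C a)| * (2 * r * R ^ k) <= n ^ k) ->
  n ^ 2 <= 8 * R ^ 2 * #|~: \bigcup_a C a|.
Proof.
move=> hR r0 R1 nR few; set U := \bigcup_a C a.
have n0 : 0 < n by lia.
pose good := copies R U.
(* Each good map is determined by one of R^k maps [g], a color, a copy in [C a] and n^(R-k) free
   values; [few] makes the total at most n^R / 2. *)
have cgood : #|good| * 2 <= n ^ R.
  have [kR|Rk] := leqP k R; last first.
    have [a [f [fi _]]] := hR (fun=> Ordinal r0).
    by have := leq_card f fi; rewrite !card_ord leqNgt Rk.
  have h1 : #|good| <= \sum_(g : {ffun 'I_k -> 'I_R}) \sum_(a < r) #|copies k (C a)| * n ^ (R - k).
    apply: (@leq_trans (\sum_(g : {ffun 'I_k -> 'I_R} | injectiveb g)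
        \sum_(a < r) #|[set f : {ffun 'I_R -> 'I_n} | [ffun x => f (g x)] \in copies k (C a)]|)).
      rewrite pair_big /=; apply: card_sum_le => f;
        rewrite inE => /andP[/injectiveP fi /(pairs_subP _ fi) fU].
      (* An edge gets a color whose container holds its image. The default is never met on edges,
         all of which [f] sends into [U]. *)
      pose col (S : {set complete R}) : 'I_r :=
        odflt (Ordinal r0) [pick a | [exists e in C a, val e == f @: (S : {set 'I_R})]].
      have [a [g [gi gcol]]] := hR col.
      exists ([ffun x => g x], a) => /=.
        by rewrite andbT; apply/injectiveP => x y; rewrite !ffunE => /gi.
      have hi : injective [ffun x : 'I_k => f ([ffun x => g x] x)].
        by move=> x y; rewrite !ffunE => /fi/gi.
      rewrite !inE; apply/andP; split; first exact/injectiveP.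
      apply/(pairs_subP _ hi) => x y xy; rewrite !ffunE.
      have := gcol x y xy; rewrite /= /class_adj /col /= => /andP[gxy].
      case: pickP => [a' ha' /eqP <- /=|none _].
        by move: ha'; rewrite imsetU1 imset_set1.
      have /existsP[e /andP[/bigcupP[a' _ eC] /eqP ev]] := fU _ _ gxy.
      have /existsP[] := none a'; exists e; by rewrite eC ev imsetU1 imset_set1 eqxx.
    apply: (@leq_trans (\sum_(g : {ffun 'I_k -> 'I_R} | injectiveb g)
        \sum_(a < r) #|copies k (C a)| * n ^ (R - k))); last first.
      by rewrite [X in _ <= X](bigID (fun g : {ffun 'I_k -> 'I_R} => injectiveb g)) leq_addr.
    apply: leq_sum => g /injectiveP gi; apply: leq_sum => a _.
    rewrite -sum_nat_const.
    apply: (@leq_trans (\sum_(h in copies k (C a)) #|[set f : {ffun 'I_R -> 'I_n} | [forall x, f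
      (g x) == h x]]|)).
      apply: card_sum_le => f; rewrite inE => fC.
      by eexists; first exact: fC; rewrite inE; apply/forallP => x; rewrite ffunE.
    apply: leq_sum => h _; apply: leq_trans (prod_comp_le _ gi) _; by rewrite !card_ord.
  rewrite sum_nat_const card_ffun !card_ord -big_distrl /= in h1.
  have h2 : (\sum_(a < r) #|copies k (C a)|) * (2 * r * R ^ k) <= r * n ^ k.
    rewrite big_distrl /=; apply: (@leq_trans (\sum_(a < r) n ^ k)); first exact: leq_sum.
    by rewrite sum_nat_const card_ord.
  have nR_eq : n ^ R = n ^ k * n ^ (R - k) by rewrite -expnD subnKC.
  rewrite -(leq_pmul2l r0) nR_eq [X in _ <= X]mulnA.
  apply: leq_trans (leq_mul h2 (leqnn (n ^ (R - k)))).
  have -> : r * (#|good| * 2) = r * 2 * #|good| by ring.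
  by apply: leq_trans (leq_mul (leqnn (r * 2)) h1) _; apply: eq_leq; ring.
have cbad : n ^ R <= #|good| + R ^ 2 * (n + 2 * #|~: U|) * n ^ (R - 2).
  rewrite -[in X in X <= _](card_ord n) -[in X in X <= _](card_ord R) -card_ffun -(cardsC good).
  rewrite leq_add2l.
  pose BP := [set p : 'I_n * 'I_n | ~~ [exists e in U, val e == [set p.1; p.2]]].
  pose sec (q : 'I_R * 'I_R) (p : 'I_n * 'I_n) :=
    [set f : {ffun 'I_R -> 'I_n} | [forall b : bool, f (if b then q.1 else q.2) == if b then p.1
      else p.2]].
  apply: (@leq_trans (\sum_(q : 'I_R * 'I_R | q.1 != q.2) \sum_(p in BP) #|sec q p|)).
    rewrite pair_big_dep /=; apply: card_sum_le => f fbad.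
    have [[x y] /andP[/= xy fxy]|none] := pickP (fun q : 'I_R * 'I_R =>
       (q.1 != q.2) && ((f q.1, f q.2) \in BP)).
      exists ((x, y), (f x, f y)); first by rewrite xy.
      by rewrite inE; apply/forallP => -[].
    have h x y : x != y -> [exists e in U, val e == [set f x; f y]].
      by move=> xy; move: (none (x, y)); rewrite /= xy inE /= => /negbFE.
    have fi : injective f.
      move=> x y fxy; apply/eqP; apply: contraT => /h/existsP[e /andP[_ /eqP ev]].
      by have := valP e; rewrite /= ev fxy setUid cards1.
    move: fbad; rewrite !inE negb_and => /orP[/injectiveP//|/negP[]].
    exact/(pairs_subP _ fi).
  apply: (@leq_trans (\sum_(q : 'I_R * 'I_R) \sum_(p in BP) n ^ (R - 2))).
    rewrite [X in _ <= X](bigID (fun q : 'I_R * 'I_R => q.1 != q.2)) /=.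
    apply: leq_trans (leq_addr _ _); apply: leq_sum => -[x y] /= xy; apply: leq_sum => p _.
    apply: leq_trans (prod_comp_le _ _) _; last by rewrite !card_ord card_bool.
    by move=> [] [] //= e; rewrite e eqxx in xy.
  rewrite !sum_nat_const card_prod card_ord !mulnA mulnn leq_mul2r leq_mul2l.
  by rewrite card_missing !orbT.
have eR : n ^ R = n ^ 2 * n ^ (R - 2) by rewrite -expnD subnKC.
have : n ^ R <= 2 * (R ^ 2 * (n + 2 * #|~: U|) * n ^ (R - 2)) by lia.
rewrite eR mulnA leq_pmul2r ?expn_gt0 ?n0 // => h.
(* The diagonal pairs contribute 2 R^2 n, at most n^2 / 2; this doubles the constant 4 R^2 to 8
   R^2. *)
have : 4 * R ^ 2 * n <= n * n by rewrite leq_mul2r nR orbT.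
move: h; rewrite !mulnDr (expnS n 1) expn1; lia.
Qed.

(** * Ramsey numbers *)

(** Induction on the sum of the targets [t a]: fix x, pass to its neighbors in a frequent color b
    and lower [t b] by one. This is why the targets vary with the color. *)
Lemma ramsey_multicolor r (T : finType) (col : {set T} -> 'I_r) : 1 < r ->
  forall s (t : 'I_r -> nat) (A : {set T}), \sum_a t a = s -> r ^ s <= #|A| ->
  exists a (B : {set T}), [/\ B \subset A, #|B| = t a &
    {in B &, forall x y, x != y -> col [set x; y] = a}].
Proof.
move=> r1; elim=> [|s IH] t A ts As.
  have r0 : 0 < r by lia.
  exists (Ordinal r0), set0; split; [exact: sub0set | | by move=> x y; rewrite inE].
  rewrite cards0; apply/esym; by move/eqP: ts; rewrite sum_nat_eq0 => /forallP/(_ (Ordinal r0))/eqP.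
have [a /eqP ta0|tn0] := pickP (fun a => t a == 0).
  exists a, set0; split; [exact: sub0set | by rewrite cards0 ta0 | by move=> x y; rewrite inE].
have /card_gt0P[x xA] : 0 < #|A| by apply: leq_trans As; rewrite expn_gt0 ltnW.
pose N b := [set y in A :\ x | col [set x; y] == b].
(* Removing x costs one element, but classes all smaller than r^s would total at most r^(s+1) - r,
   and r > 1. *)
have [b hb] : exists b, r ^ s <= #|N b|.
  apply/existsP; apply: contraT => /existsPn h.
  have h1 : \sum_(b < r) #|N b| = #|A :\ x|.
    rewrite -sum1_card (partition_big (fun y => col [set x; y]) predT) //=.
    by apply: eq_bigr => b _; rewrite -sum1dep_card; apply: eq_bigl => y; rewrite inE.
  have h2 : \sum_(b < r) (#|N b|).+1 <= r * r ^ s.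
    rewrite -[X in X * _]card_ord -sum_nat_const; apply: leq_sum => b _.
    by rewrite ltnNge; apply: h.
  have h3 : \sum_(b < r) (#|N b|).+1 = #|A :\ x| + r.
    under eq_bigr do rewrite -addn1.
    by rewrite big_split /= h1 sum_nat_const card_ord muln1.
  have := cardsD1 x A; rewrite xA; rewrite expnS in As; lia.
pose t' a := if a == b then (t b).-1 else t a.
have ts' : \sum_a t' a = s.
  have e : \sum_(a | a != b) t' a = \sum_(a | a != b) t a.
    by apply: eq_bigr => a /negbTE ab; rewrite /t' ab.
  move: ts; rewrite (bigD1 b) //= => ts; rewrite (bigD1 b) //= e /t' eqxx.
  by move: ts (tn0 b); case: (t b) => //= p [].
have [a [B [BN cB monoB]]] := IH t' (N b) ts' hb.
have BA : B \subset A.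
  by apply: subset_trans BN _; apply/subsetP => y; rewrite !inE => /andP[/andP[_ ->]].
have [ab|ab] := eqVneq a b; last first.
  by exists a, B; split=> //; rewrite cB /t' (negbTE ab).
exists b, (x |: B); split.
- by rewrite subUset sub1set xA.
- rewrite cardsU1 cB /t' ab eqxx.
  have -> : x \notin B by apply/negP => /(subsetP BN); rewrite !inE eqxx.
  by rewrite add1n prednK // lt0n tn0.
have xB y : y \in B -> col [set x; y] = b by move/(subsetP BN); rewrite inE => /andP[_ /eqP].
move=> y z; rewrite !inE => /predU1P[->|yB] /predU1P[->|zB] //; rewrite ?eqxx //.
- by move=> _; apply: xB.
- by move=> _; rewrite setUC; apply: xB.
- by rewrite -ab; apply: monoB.
Qed.

(** The exponent rk is the source of the term k^3 r log r in the final bound. *)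
Lemma ramsey_upper k r : 1 < r -> arrows (complete (r ^ (r * k))) (complete k) r.
Proof.
move=> r1 col.
have [||a [B [_ cB monoB]]] := ramsey_multicolor col r1 (s := r * k) (t := fun=> k) (A := setT).
- by rewrite sum_nat_const card_ord.
- by rewrite cardsT card_ord.
exists a, (fun i => enum_val (cast_ord (esym cB) i)); split.
  by move=> i j /enum_val_inj/cast_ord_inj.
move=> i j ij; have nij : enum_val (cast_ord (esym cB) i) != enum_val (cast_ord (esym cB) j).
  by rewrite (inj_eq enum_val_inj) (inj_eq (@cast_ord_inj _ _ _)).
by rewrite /= /class_adj /= nij monoB ?enum_valP /=.
Qed.

(* Colour each edge by its smaller endpoint: a triangle uses two colours. *)
Lemma ramsey_lower k r R : 0 < r -> 2 < k -> arrows (complete R) (complete k) r -> r < R.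
Proof.
move=> r0 k2 hR; rewrite ltnNge; apply/negP => Rr.
pose col (S : {set complete R}) : 'I_r :=
  if [pick x : 'I_R in S | [forall y : 'I_R in S, x <= y]] is Some x then widen_ord Rr x
  else Ordinal r0.
have colE (x y : 'I_R) : col [set x; y] = minn x y :> nat.
  rewrite /col; case: pickP => [z /andP[]|none].
    rewrite !inE => zxy /forall_inP min_z /=.
    have := min_z x; have := min_z y; rewrite !inE !eqxx orbT => /(_ isT) h1 /(_ isT) h2.
    by case/orP: zxy => /eqP ez; subst z; lia.
  have [xy|yx] := leqP x y.
    move: (none x); rewrite !inE eqxx /= => /forall_inP[] z; rewrite !inE => /orP[]/eqP-> //.
  move: (none y); rewrite !inE eqxx orbT /= => /forall_inP[] z; rewrite !inE => /orP[]/eqP-> //.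
  exact: ltnW.
have [a [f [fi fcol]]] := hR col.
have i0 : 0 < k by lia.
have i1 : 1 < k by lia.
have c01 := fcol (Ordinal i0) (Ordinal i1) isT.
have c02 := fcol (Ordinal i0) (Ordinal k2) isT.
have c12 := fcol (Ordinal i1) (Ordinal k2) isT.
move: c01 c02 c12; rewrite /= /class_adj /= -!val_eqE /= !colE; lia.
Qed.

(** * Hypergraph containers *)

Local Open Scope ring_scope.

(** * Weighted hypergraphs: degrees, links and double counting *)

Section Weights.
Variables (F : realFieldType) (V : finType).
Implicit Types (w : {set V} -> F) (S E I : {set V}) (v : V).

(** Hypergraphs are weight functions, so that links can be added with a multiplicity; [deg w set0]
    is the total weight. *)
Definition deg w S : F := \sum_(E : {set V} | S \subset E) w E.

Definition link w v E : F := if v \in E then 0 else w (v |: E).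

Definition uniform s w := forall E, w E != 0 -> #|E| = s.

Definition independent w I := forall E, w E != 0 -> ~~ (E \subset I).

Lemma deg_set0 w : deg w set0 = \sum_(E : {set V}) w E.
Proof. by apply: eq_bigl => E; rewrite sub0set. Qed.

Lemma deg_ge0 w S : (forall E, 0 <= w E) -> 0 <= deg w S.
Proof. by move=> w0; apply: sumr_ge0. Qed.

Lemma deg_neq0 w S : deg w S != 0 -> exists2 E : {set V}, S \subset E & w E != 0.
Proof.
move=> h; have [E /andP[SE wE]|none] := pickP (fun E : {set V} => (S \subset E) && (w E != 0)).
  by exists E.
case/eqP: h; apply: big1 => E SE.
by apply/eqP; move: (none E); rewrite SE /= => /negbFE.
Qed.

Lemma deg_le w w' S : (forall E, w E <= w' E) -> deg w S <= deg w' S.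
Proof. by move=> h; apply: Num.Theory.ler_sum. Qed.

Lemma deg_link w v S : deg (link w v) S = if v \in S then 0 else deg w (v |: S).
Proof.
case: ifPn => vS.
  apply: big1 => E /subsetP/(_ v vS) vE; by rewrite /link vE.
rewrite /deg (bigID (fun E : {set V} => v \in E)) /= big1 ?add0r; last first.
  by move=> E /andP[_ vE]; rewrite /link vE.
rewrite [RHS](reindex_onto (fun E : {set V} => v |: E) (fun E : {set V} => E :\ v)) /=; last first.
  by move=> E; rewrite subUset sub1set => /andP[vE _]; rewrite setD1K.
apply: eq_big => [E|E /andP[_ vE]]; last by rewrite /link (negbTE vE).
have -> : ((v |: E) :\ v == E) = (v \notin E).
  apply/eqP/idP => [<-|vE]; first by rewrite setD11.
  by rewrite setU1K.
case vE: (v \in E); rewrite ?andbF ?andbT //=.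
apply/idP/idP => [SE|]; first by rewrite setUS.
rewrite subUset => /andP[_ /subsetP SE]; apply/subsetP => x xS.
by move: (SE x xS); rewrite !inE => /orP[/eqP xv|//]; rewrite -xv xS in vS.
Qed.

Lemma sum_deg1 s w : uniform s w -> \sum_v deg w [set v] = s%:R * deg w set0.
Proof.
move=> us; rewrite /deg (exchange_big_dep predT) //= big_distrr /=.
apply: eq_big => [E|E _]; first by rewrite sub0set.
have [->|wE] := eqVneq (w E) 0; first by rewrite mulr0 big1.
rewrite -(us E wE) (eq_bigl (fun v => v \in E)) => [|v]; last by rewrite sub1set.
by rewrite sumr_const mulr_natl.
Qed.

Lemma sum_deg w (T : pred {set V}) : (forall E, 0 <= w E) ->
  \sum_(E : {set V} | [exists S, T S && (S \subset E)]) w E <= \sum_(S | T S) deg w S.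
Proof.
move=> w0; rewrite /deg (exchange_big_dep predT) //=.
rewrite [leRHS](bigID (fun E : {set V} => [exists S, T S && (S \subset E)])) /=.
apply: ler_wpDr; first by do 2!apply: sumr_ge0 => ? _.
apply: Num.Theory.ler_sum => E /existsP[S SE]; rewrite (bigD1 S) //= lerDl.
exact: sumr_ge0.
Qed.

Lemma sum_powersetX (x : F) E :
  \sum_(S : {set V} | S \subset E) x ^+ #|S| = (1 + x) ^+ #|E|.
Proof.
rewrite exprDn (partition_big (fun S : {set V} => inord #|S| : 'I_(#|E|.+1)) predT) //=.
apply: eq_bigr => i _; rewrite expr1n mul1r -cards_draws -sum1dep_card.
rewrite (eq_bigl (fun S : {set V} => (S \subset E) && (#|S| == i))); last first.
  move=> S; case SE: (S \subset E) => //=; rewrite -val_eqE /= inordK //.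
  by rewrite ltnS subset_leq_card.
rewrite -mulr_natr natr_sum big_distrr /=.
by apply: eq_bigr => S /andP[_ /eqP ->]; rewrite mulr1.
Qed.

Lemma exprD1_le (x : F) j : 0 <= x -> j%:R * x <= 2^-1 -> (1 + x) ^+ j <= 1 + 2 * j%:R * x.
Proof.
move=> x0; elim: j => [|j IH] h; first by rewrite expr0; lra.
have hj : j%:R * x <= 2^-1.
  by apply: le_trans h; apply: ler_wpM2r => //; rewrite ler_nat.
have jx : 0 <= j%:R * x by apply: mulr_ge0.
rewrite exprSr; apply: (@le_trans _ _ ((1 + 2 * j%:R * x) * (1 + x))).
  by apply: ler_wpM2r; [lra | apply: IH].
have h2 : x * (j%:R * x) <= x * 2^-1 by apply: ler_wpM2l.
rewrite -(natr1 j); nra.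
Qed.
End Weights.

(** * Finding a large set of vertices disjoint from a given independent set *)

Section Step.
Variables (F : realFieldType) (V : finType) (mu : V -> F) (N m : nat) (c : F).
Hypotheses (mu0 : forall v, 0 <= mu v) (VN : (#|V| <= N)%N) (N0 : (0 < N)%N) (m0 : (0 < m)%N).
Implicit Types (w B : {set V} -> F).

(* [mu] is a reference measure on the vertices; relative to it, [w] has codegrees
   comparable to those of a random hypergraph of density [sigma]. *)
Definition spread (K sigma : F) w :=
  forall (S : {set V}) v, v \in S -> deg w S <= K * sigma ^+ #|S|.-1 * mu v.

Definition saturated (thr : nat -> F) B (S : {set V}) :=
  [exists v in S, deg B S > thr #|S| * mu v].

Definition unsaturated (thr : nat -> F) B w (E : {set V}) : F :=
  if [exists S : {set V}, saturated thr B S && (S \subset E)] then 0 else w E.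

(* A saturated set S has [deg w S <= deg B S / (2 c^|S|)], and each E in the
   support of B contributes [B E * ((1 + 1/c)^|E| - 1) <= B E] to the sum of
   [deg B S / c^|S|]; so the discarded edges weigh at most 1/2. *)
Lemma unsaturated_total w B K sigma s :
  (forall E, 0 <= w E) -> (forall E, 0 <= B E) -> 0 < K -> 0 < sigma ->
  (2 * s%:R <= c) -> 0 < c -> uniform s B -> spread K sigma w -> deg B set0 <= 1 ->
  deg w set0 - 2^-1 <= deg (unsaturated (fun j => 2 * c ^+ j * K * sigma ^+ j.-1) B w) set0.
Proof.
move=> w0 B0 K0 s0 sc c0 uB wK B1.
set thr := fun j => _; set A := unsaturated _ _ _.
have wA E : w E = A E + (if [exists S : {set V}, saturated thr B S && (S \subset E)] then w E
  else 0).
  by rewrite /A /unsaturated; case: ifP => _; rewrite ?addr0 ?add0r.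
have -> : deg w set0 = deg A set0 + \sum_(E : {set V} | [exists S : {set V}, saturated thr B S
  && (S \subset E)]) w E.
  rewrite /deg (eq_bigr _ (fun E _ => wA E)) big_split /= -big_mkcondr /=; congr (_ + _).
  by apply: eq_bigl => E; rewrite sub0set.
rewrite lerBlDr lerD2l.
have kill S : saturated thr B S -> deg w S <= 2^-1 * (c^-1 ^+ #|S| * deg B S).
  move=> /existsP[v /andP[vS hv]]; apply: le_trans (wK S v vS) _.
  have tp : 0 < 2 * c ^+ #|S| by rewrite mulr_gt0 // exprn_gt0.
  rewrite -(ler_pM2l tp) [leRHS](_ : _ = deg B S); last first.
    by rewrite exprVn; field; rewrite expf_neq0 // gt_eqF.
  by apply: le_trans (ltW hv); rewrite /thr !mulrA.
have B_ge0 S := deg_ge0 S B0.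
apply: (@le_trans _ _ (\sum_(S | saturated thr B S) deg w S)).
  exact: sum_deg.
apply: (@le_trans _ _ (\sum_(S | saturated thr B S) 2^-1 * (c^-1 ^+ #|S| * deg B S))).
  by apply: Num.Theory.ler_sum => S /kill.
rewrite -big_distrr /= ler_piMr ?invr_ge0 //.
have cV : 0 <= c^-1 by rewrite invr_ge0 ltW.
apply: (@le_trans _ _ (\sum_(S : {set V} | S != set0) c^-1 ^+ #|S| * deg B S)).
  rewrite [leRHS](bigID (saturated thr B)) /= ler_wpDr //.
    by apply: sumr_ge0 => S _; rewrite mulr_ge0 ?exprn_ge0.
  rewrite le_eqVlt; apply/orP; left; apply/eqP; apply: eq_bigl => S.
  case: eqVneq => // ->; apply/negbTE/existsP => -[v /andP[]]; by rewrite inE.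
apply: le_trans B1; rewrite /deg.
under eq_bigr do rewrite big_distrr /=.
rewrite (exchange_big_dep predT) //= [leRHS](eq_bigl predT) => [|E]; last by rewrite sub0set.
apply: Num.Theory.ler_sum => E _; have [->|BE] := eqVneq (B E) 0.
  by rewrite big1 // => S _; rewrite mulr0.
rewrite -big_distrl /= ler_piMl //.
have := sum_powersetX c^-1 E; rewrite (bigD1 set0) ?sub0set //= cards0 expr0 (uB E BE).
rewrite (eq_bigl (fun S : {set V} => (S != set0) && (S \subset E))) => [h|S]; last by rewrite andbC.
have h2 : s%:R * c^-1 <= 2^-1.
  by rewrite -(ler_pM2r c0) mulfVK ?gt_eqF //; lra.
have := exprD1_le cV h2; rewrite -h; lra.
Qed.

(* Induction on the uniformity. Given an independent set I, repeatedly choose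
   v in I of degree at least 1/(4N) and add the link of v, which is again
   independent from I, to a hypergraph B of lower uniformity; edges of w that
   contain a set already saturated in B are discarded, which keeps B spread.
   Either m choices give B total weight 1 and the induction hypothesis applies,
   or the set D0 of all vertices of large degree misses I. Only the sequence of
   the chosen vertices matters, so there are at most (N+1)^m outcomes per level. *)
Lemma container_step s : forall w (K sigma : F),
  uniform s.+1 w -> (forall E, 0 <= w E) -> 1 <= deg w set0 ->
  spread K sigma w -> 0 < K -> 0 < sigma -> 1 <= c -> 2 * s%:R <= c ->
  4 * N%:R / m%:R * sigma * c ^+ s <= 2 * c ->
  exists DD : {set {set V}},
    [/\ (#|DD| <= N.+1 ^ (s * m))%N,
        forall D : {set V}, D \in DD -> (4 * K * (4 * c) ^+ s)^-1 <= \sum_(v in D) mu v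
      & forall I : {set V}, independent w I -> exists2 D : {set V}, D \in DD & [disjoint D & I]].
Proof.
have Nr : 0 < N%:R :> F by rewrite ltr0n.
have mr : 0 < m%:R :> F by rewrite ltr0n.
elim: s => [|s IH] w K sigma us w0 w1 wK K0 sig0 c1 sc lam.
  (* In uniformity 1 an independent set avoids the whole support, which is the only outcome. *)
  exists [set [set v | w [set v] != 0]]; split=> [|D|I Iw]; first by rewrite cards1.
    rewrite inE => /eqP ->; rewrite expr0 mulr1 -(@ler_pM2l _ (4 * K)); last by lra.
    rewrite mulfV; last by lra.
    have h v : deg w [set v] = w [set v].
      rewrite /deg (bigD1 [set v]) //= big1 ?addr0 // => E /andP[vE Ev].
      apply/eqP; apply: contraNT Ev => wE; rewrite eq_sym eqEcard vE (us E wE) cards1 //.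
    have := sum_deg1 us; rewrite mul1r.
    rewrite (bigID (fun v => v \in [set v | w [set v] != 0])) /=.
    rewrite [X in _ + X]big1 ?addr0; last first.
      by move=> v; rewrite inE negbK => /eqP; rewrite h.
    move=> e; rewrite -e in w1; have : 1 <= K * \sum_(v in [set v | w [set v] != 0]) mu v.
      apply: le_trans w1 _; rewrite big_distrr /=; apply: Num.Theory.ler_sum => v _.
      by have := wK [set v] v (set11 v); rewrite cards1 expr0 mulr1.
    nra.
  exists [set v | w [set v] != 0]; first by rewrite inE.
  rewrite disjoints_subset; apply/subsetP => v; rewrite !inE => /Iw.
  by rewrite sub1set.
(* A chosen vertex has degree at least 1/(4N), so its link scaled by [lambda] adds at least 1/m to
   B, and m choices reach weight 1. *)
pose lambda : F := 4 * N%:R / m%:R; rewrite -/lambda in lam IH.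
have lam0 : 0 < lambda by rewrite divr_gt0 // mulr_gt0.
have cs1 j : 1 <= c ^+ j by apply: exprn_ege1.
have lams : lambda * sigma <= 2 * c.
  apply: le_trans lam; rewrite ler_peMr //; by apply/ltW/mulr_gt0.
have thr0 j : 0 <= 2 * c ^+ j * K * sigma ^+ j.-1.
  by rewrite !mulr_ge0 ?exprn_ge0 //; lra.
have c0 : 0 < c by lra.
(* Here i is the number of choices still available when the current link hypergraph is B. *)
pose good (B : {set V} -> F) i := exists DD : {set {set V}},
    [/\ (#|DD| <= N.+1 ^ (i + s * m))%N,
        forall D : {set V}, D \in DD -> (4 * K * (4 * c) ^+ s.+1)^-1 <= \sum_(v in D) mu v
      & forall I : {set V}, independent w I -> independent B I ->
           exists2 D : {set V}, D \in DD & [disjoint D & I]].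
have big B i : (forall E, 0 <= B E) -> uniform s.+1 B ->
    spread (4 * c * K) (c * sigma) B -> 1 <= deg B set0 -> good B i.
  move=> B0 uB BK B1.
  have sc' : 2 * s%:R <= c by apply: le_trans sc; rewrite ler_pM2l // ler_nat.
  have lam' : lambda * (c * sigma) * c ^+ s <= 2 * c.
    by apply: le_trans lam; rewrite exprS [c * sigma]mulrC !mulrA.
  have [DD [cDD muDD iDD]] := IH B _ _ uB B0 B1 BK (mulr_gt0 (mulr_gt0 (ltr0n _ 4) c0) K0)
    (mulr_gt0 c0 sig0) c1 sc' lam'.
  exists DD; split=> [|D /muDD|I _ /iDD//].
    by apply: leq_trans cDD _; rewrite leq_exp2l // leq_addl.
  by rewrite exprS; congr (_^-1 <= _); ring.
have key i : forall B, (forall E, 0 <= B E) -> uniform s.+1 B ->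
    spread (4 * c * K) (c * sigma) B -> 1 - i%:R / m%:R <= deg B set0 -> good B i.
  elim: i => [|i IHi] B B0 uB BK Bi.
    by apply: big => //; move: Bi; rewrite mul0r subr0.
  have [|B1] := leP 1 (deg B set0); first exact: big.
  (* This is half of what [spread (4 * c * K) (c * sigma)] allows; the other half is room for the
     next link. *)
  pose thr j := 2 * c ^+ j * K * sigma ^+ j.-1.
  pose A := unsaturated thr B w.
  have A0 E : 0 <= A E by rewrite /A /unsaturated; case: ifP.
  have Aw E : A E <= w E by rewrite /A /unsaturated; case: ifP.
  have uA : uniform s.+2 A.
    by move=> E; rewrite /A /unsaturated; case: ifP => [_|_ /us//]; rewrite eqxx.
  have A2 : 2^-1 <= deg A set0.
    have : deg w set0 - 2^-1 <= deg A set0.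
      apply: (@unsaturated_total _ _ _ _ s.+1) => //; exact: ltW.
    lra.
  pose D0 := [set v | (4 * N%:R)^-1 <= deg A [set v]].
  (* The degrees in A sum to at least 1/2, and vertices outside [D0] account for at most 1/4. *)
  have D0mu : (4 * K * (4 * c) ^+ s.+1)^-1 <= \sum_(v in D0) mu v.
    have h1 := sum_deg1 uA; rewrite (bigID (mem D0)) /= in h1.
    have h2 : \sum_(v | v \notin D0) deg A [set v] <= 4^-1.
      apply: (@le_trans _ _ (\sum_(v : V) (4 * N%:R)^-1)).
        rewrite [leRHS](bigID (mem D0)) /= ler_wpDl //.
          by apply: sumr_ge0 => v _; rewrite invr_ge0 mulr_ge0 // ltW.
        apply: Num.Theory.ler_sum => v; rewrite inE -ltNge; exact: ltW.
      rewrite sumr_const -[_ *+ _]mulr_natl ler_pdivrMr ?mulr_gt0 //.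
      by rewrite mulrA mulVf ?mul1r ?ler_nat // gt_eqF.
    have h3 : \sum_(v in D0) deg A [set v] <= K * \sum_(v in D0) mu v.
      rewrite big_distrr /=; apply: Num.Theory.ler_sum => v _.
      apply: le_trans (deg_le _ Aw) _.
      by have := wK [set v] v (set11 v); rewrite cards1 expr0 mulr1.
    have h4 : 2^-1 <= s.+2%:R * deg A set0.
      by apply: le_trans A2 _; rewrite ler_peMl ?deg_ge0 // ler1n.
    have h5 : 4^-1 <= K * \sum_(v in D0) mu v by lra.
    have h6 : 1 <= (4 * c) ^+ s.+1 by apply: exprn_ege1; lra.
    have h7 : (4 * K)^-1 <= \sum_(v in D0) mu v.
      by rewrite invfM mulrC ler_pdivrMl.
    apply: le_trans h7; rewrite lef_pV2 ?posrE ?mulr_gt0 ?exprn_gt0 //; try lra.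
    by rewrite ler_peMr //; lra.
  pose B' v E := B E + lambda * link A v E.
  have degB' v S : deg (B' v) S = deg B S + lambda * (if v \in S then 0 else deg A (v |: S)).
    by rewrite -deg_link /deg big_split big_distrr.
  have l0 v E : 0 <= link A v E by rewrite /link; case: ifP.
  have step v : v \in D0 -> exists DD : {set {set V}},
    [/\ (#|DD| <= N.+1 ^ (i + s * m))%N,
        forall D : {set V}, D \in DD -> (4 * K * (4 * c) ^+ s.+1)^-1 <= \sum_(v in D) mu v
      & forall I : {set V}, independent w I -> independent B I -> v \in I ->
           exists2 D : {set V}, D \in DD & [disjoint D & I]].
    rewrite inE => vD0.
    have [||||DD [cDD muDD iDD]] := IHi (B' v).
    + by move=> E; rewrite addr_ge0 // mulr_ge0 // ltW.
    + move=> E; have [B_0|BE _] := eqVneq (B E) 0; last exact: uB.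
      rewrite /B' B_0 add0r mulf_eq0 negb_or => /andP[_]; rewrite /link.
      case: ifP => [_|vE]; first by rewrite eqxx.
      by move=> /uA; rewrite cardsU1 vE => -[].
    + move=> S x xS; rewrite degB'.
      have Bx := BK S x xS.
      case: ifPn => [_|vS]; first by rewrite mulr0 addr0.
      (* If the link adds anything at S, an edge of A contains S, so S is unsaturated and [deg B S]
         is below the threshold. *)
      have [->|/deg_neq0[E vSE AE]] := eqVneq (deg A (v |: S)) 0.
        by rewrite mulr0 addr0.
      have xvS : x \in v |: S by rewrite inE xS orbT.
      have := wK _ _ xvS; rewrite cardsU1 vS /= => wx.
      have Ax := le_trans (deg_le (v |: S) Aw) wx.
      have {}Bx : deg B S <= thr #|S| * mu x.
        rewrite leNgt; apply: contra AE => hS; rewrite /A /unsaturated ifT //.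
        apply/existsP; exists S; rewrite (subset_trans _ vSE) ?subsetUr // andbT.
        by apply/existsP; exists x; rewrite xS.
      apply: le_trans (lerD Bx (ler_wpM2l (ltW lam0) Ax)) _.
      rewrite mulrA -mulrDl; apply: ler_wpM2r => //.
      have [j ->] : exists j, #|S| = j.+1.
        by exists #|S|.-1; rewrite prednK // card_gt0; apply/set0Pn; exists x.
      rewrite /thr /= exprMn !exprS.
      have p1 : 0 <= K * sigma ^+ j by rewrite mulr_ge0 ?exprn_ge0 // ltW.
      have p2 : lambda * sigma <= 2 * c * c ^+ j.
        by apply: le_trans lams _; rewrite ler_peMr //; lra.
      have := ler_wpM2r p1 p2; lra.
    + rewrite degB' inE setU0; apply: le_trans (lerD (lexx _) (ler_wpM2l (ltW lam0) vD0)).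
      have -> : lambda * (4 * N%:R)^-1 = m%:R^-1.
        by rewrite /lambda; field; rewrite !gt_eqF.
      by move: Bi; rewrite -natr1 mulrDl mul1r; lra.
    exists DD; split=> // I wI BI vI; apply: iDD => // E.
    have [B_0|BE _] := eqVneq (B E) 0; last exact: BI.
    rewrite /B' B_0 add0r mulf_eq0 negb_or => /andP[_]; rewrite /link.
    case: ifP => [_|vE]; first by rewrite eqxx.
    rewrite /A /unsaturated; case: ifP => [_|_ /wI]; first by rewrite eqxx.
    by rewrite subUset sub1set vI.
  have step' v : exists DD : {set {set V}}, v \in D0 ->
    [/\ (#|DD| <= N.+1 ^ (i + s * m))%N,
        forall D : {set V}, D \in DD -> (4 * K * (4 * c) ^+ s.+1)^-1 <= \sum_(v in D) mu v
      & forall I : {set V}, independent w I -> independent B I -> v \in I ->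
           exists2 D : {set V}, D \in DD & [disjoint D & I]].
    have [/step[DD h]|_] := boolP (v \in D0); first by exists DD.
    by exists set0.
  have [DD hDD] := fin_all_exists step'.
  exists (D0 |: \bigcup_v (if v \in D0 then DD v else set0)); split.
  - rewrite (leq_trans (leq_card_setU _ _)) // cards1 [(i.+1 + _)%N]addSn expnS mulSn leq_add //.
      by rewrite expn_gt0.
    apply: leq_trans (card_bigcup_le _ _) _.
    apply: (@leq_trans (\sum_(v : V) N.+1 ^ (i + s * m))).
      by apply: leq_sum => v _; case: ifP => [/hDD[]//|_]; rewrite cards0.
    by rewrite sum_nat_const leq_mul2r VN orbT.
  - move=> D; rewrite in_setU1 => /orP[/eqP->//|/bigcupP[v _]].
    by case: ifP => [/hDD[_ + _]|_]; [exact | rewrite inE].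
  - move=> I wI BI; have [dis|] := boolP [disjoint D0 & I].
      by exists D0; rewrite ?setU11.
    rewrite -setI_eq0 => /set0Pn[v]; rewrite inE => /andP[vD0 vI].
    have [_ _ /(_ I wI BI vI)[D DDD dis]] := hDD v vD0.
    exists D => //; rewrite in_setU1; apply/orP; right.
    by apply/bigcupP; exists v; rewrite ?vD0.
have [||||DD [cDD muDD iDD]] := key m (fun=> 0).
- by [].
- by move=> E; rewrite eqxx.
- move=> S v _; rewrite /deg big1 //; rewrite !mulr_ge0 ?exprn_ge0 //; nra.
- by rewrite divff ?subrr ?deg_ge0 // gt_eqF.
exists DD; split=> // I wI; apply: iDD => // E; by rewrite eqxx.
Qed.
End Step.

(** * Iteration to containers of small weight *)

Section Containers.
Variables (F : realFieldType) (V : finType) (N m s : nat) (sigma eps : F) (w : {set V} -> F).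
Hypotheses (VN : (#|V| <= N)%N) (N0 : (0 < N)%N) (m0 : (0 < m)%N).
Hypotheses (sigma0 : 0 < sigma) (eps0 : 0 < eps).
Hypotheses (w0 : forall E, 0 <= w E) (uw : uniform s.+1 w).
Let c : F := 2 * s.+1%:R.
Hypothesis sigma_le : 4 * N%:R / m%:R * sigma * c ^+ s <= 2 * c.
Hypothesis codeg : forall S : {set V}, (1 < #|S|)%N ->
  deg w S <= sigma ^+ #|S|.-1 * (eps / (2 * N%:R)).

Definition induced (C E : {set V}) : F := if E \subset C then w E else 0.

Lemma induced_ge0 C E : 0 <= induced C E.
Proof. by rewrite /induced; case: ifP. Qed.

(* The reference measure is the degree measure of C (after removing the edges
   through vertices of low degree), so the number of edges drops by a factor
   independent of the density of C, and the number of iterations is only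
   logarithmic in 1/eps. *)
Lemma container_shrink (C : {set V}) : eps <= deg (induced C) set0 ->
  exists DD : {set {set V}},
  [/\ (#|DD| <= N.+1 ^ (s * m))%N,
      forall D : {set V}, D \in DD ->
        deg (induced (C :\: D)) set0 <= (1 - ((4 * c) ^+ s.+1)^-1) * deg (induced C) set0
    & forall I : {set V}, independent w I -> exists2 D : {set V}, D \in DD & [disjoint D & I]].
Proof.
set e := deg (induced C) set0 => eC.
have e0 : 0 < e by apply: lt_le_trans eC.
have Nr : 0 < N%:R :> F by rewrite ltr0n.
have c1 : 1 <= c by rewrite /c -natrM ler1n.
have c0 : 0 < c by lra.
pose d v := deg (induced C) [set v].
have d0 v : 0 <= d v by apply: deg_ge0; exact: induced_ge0.
(* Edges through vertices of degree below [eta] weigh at most [eps / 2], so at least half of [e]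
   survives and scaling by [2 / e] gives total weight at least 1. *)
pose eta := eps / (2 * N%:R).
have eta0 : 0 < eta by rewrite divr_gt0 // mulr_gt0.
have etaN : N%:R * eta = eps / 2 by rewrite /eta; field; rewrite gt_eqF.
pose mu v := 2 / e * d v.
have q0 : 0 < 2 / e by rewrite divr_gt0.
have mu0 v : 0 <= mu v by rewrite mulr_ge0 // ltW.
pose low (E : {set V}) := [exists v in E, d v < eta].
pose w' E := if low E then 0 else 2 / e * induced C E.
have w'le E : w' E <= 2 / e * induced C E.
  by rewrite /w'; case: ifP => // _; rewrite mulr_ge0 ?induced_ge0 // ltW.
have w'0 E : 0 <= w' E.
  by rewrite /w'; case: ifP => // _; rewrite mulr_ge0 ?induced_ge0 // ltW.
have w'neq E : w' E != 0 -> [/\ E \subset C, w E != 0 & forall v, v \in E -> eta <= d v].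
  rewrite /w'; case: ifPn => [_|/existsPn h]; first by rewrite eqxx.
  rewrite mulf_eq0 negb_or /induced => /andP[_]; case: ifP => [EC wE|_]; last by rewrite eqxx.
  by split=> // v vE; move: (h v); rewrite vE /= -leNgt.
have degw' S : deg w' S <= 2 / e * deg (induced C) S.
  by rewrite /deg big_distrr; apply: Num.Theory.ler_sum => E _; exact: w'le.
have e2 : e / 2 * (2 / e) = 1 by field; rewrite gt_eqF.
have w'1 : 1 <= deg w' set0.
  have : e <= \sum_(E : {set V}) (if low E then induced C E else 0) + e / 2 * deg w' set0.
    rewrite {1}/e !deg_set0 big_distrr /=.
    rewrite -big_split; apply: Num.Theory.ler_sum => E _ /=; rewrite /w'.
    case: ifP => _; rewrite ?mulr0 ?addr0 ?add0r //.
    by rewrite [leRHS]mulrA e2 mul1r.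
  have : \sum_(E : {set V}) (if low E then induced C E else 0) <= e / 2.
    apply: (@le_trans _ _ (\sum_(v | d v < eta) d v)).
      rewrite /d /deg (exchange_big_dep predT) //=; apply: Num.Theory.ler_sum => E _.
      have ge0 (P : pred V) : 0 <= \sum_(v | P v) induced C E.
        by apply: sumr_ge0 => v _; exact: induced_ge0.
      case: ifP => // /existsP[v /andP[vE hv]].
      by rewrite (bigD1 v) /= ?hv ?sub1set // lerDl.
    apply: (@le_trans _ _ (\sum_(v : V) eta)).
      rewrite [leRHS](bigID (fun v => d v < eta)) /= ler_wpDr ?sumr_ge0 // => [v _|].
        exact: ltW.
      by apply: Num.Theory.ler_sum => v /ltW.
    rewrite sumr_const -[_ *+ _]mulr_natl; apply: (@le_trans _ _ (N%:R * eta)).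
      by apply: ler_wpM2r; rewrite ?ler_nat // ltW.
    rewrite etaN; lra.
  move=> h1 h2; have : e / 2 * 1 <= e / 2 * deg w' set0 by lra.
  by rewrite ler_pM2l //; lra.
(* For singletons this is the choice of [mu]; for larger S it is [codeg], since vertices of edges of
   [w'] satisfy [eta <= d v]. *)
have spr : spread mu 1 sigma w'.
  move=> S v vS; rewrite mul1r.
  have [S1|S2] := leqP #|S| 1.
    have -> : S = [set v].
      by apply/eqP; rewrite eq_sym eqEcard sub1set vS cards1.
    by rewrite cards1 mul1r; exact: degw'.
  have s0 : 0 <= sigma ^+ #|S|.-1 by rewrite exprn_ge0 // ltW.
  have [->|/deg_neq0[E SE /w'neq[_ _ hE]]] := eqVneq (deg w' S) 0; first by rewrite mulr_ge0.
  have /hE hv := subsetP SE v vS.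
  apply: le_trans (degw' S) _; rewrite /mu mulrCA; apply: ler_wpM2l; first exact: ltW.
  apply: (@le_trans _ _ (deg w S)).
    by apply: deg_le => E'; rewrite /induced; case: ifP.
  by apply: le_trans (codeg S2) _; exact: ler_wpM2l.
have uw' : uniform s.+1 w' by move=> E /w'neq[_ /uw].
have sc : 2 * s%:R <= c by rewrite /c ler_pM2l // ler_nat.
have [DD [cDD muDD iDD]] :=
  container_step mu0 VN N0 m0 uw' w'0 w'1 spr ltr01 sigma0 c1 sc sigma_le.
exists DD; split=> // [D /muDD hD|I Iw]; last first.
  by apply: iDD => E /w'neq[_ /Iw].
have cov : \sum_(v in D) d v + s.+1%:R * deg (induced (C :\: D)) set0 <= s.+1%:R * e.
  rewrite /e !deg_set0 /d /deg (exchange_big_dep predT) //=.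
  rewrite !big_distrr -big_split /=; apply: Num.Theory.ler_sum => E _.
  rewrite /induced subsetD; case: ifP => [EC|_] /=; last by rewrite big1 ?add0r ?mulr0.
  have [->|/uw cE] := eqVneq (w E) 0; first by rewrite big1 // if_same !mulr0 addr0.
  case: ifPn => [dis|_].
    rewrite big_pred0 ?add0r // => v; rewrite sub1set.
    by apply/negP => /andP[vD]; rewrite (disjointFl dis vD).
  rewrite mulr0 addr0 sumr_const -[_ *+ _]mulr_natl; apply: ler_wpM2r => //.
  rewrite ler_nat -cE; apply: subset_leq_card; apply/subsetP => v.
  by case/andP => _; rewrite sub1set.
rewrite -big_distrr /= mulr1 in hD.
set x := (4 * c) ^+ s in hD *.
have x0 : 0 < x by rewrite exprn_gt0 // mulr_gt0.
have {}hD : e / 2 * (4 * x)^-1 <= \sum_(v in D) d v.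
  have := ler_wpM2l (_ : 0 <= e / 2) hD; rewrite mulrA e2 mul1r.
  by apply; lra.
have s1 : 0 < s.+1%:R :> F by rewrite ltr0n.
rewrite -(ler_pM2l s1).
(* As c = 2(s+1), the division by s+1 supplies the last factor 4c of the rate. *)
have -> : s.+1%:R * ((1 - ((4 * c) ^+ s.+1)^-1) * e) = s.+1%:R * e - e / 2 * (4 * x)^-1.
  by rewrite exprS -/x /c; field; rewrite nat1r !gt_eqF.
lra.
Qed.

(** Each shrinking round multiplies the number of containers by its number of outcomes; j is a
    budget, and a branch stops once its weight is below [eps]. *)
Lemma container_family (j : nat) : forall C : {set V},
  (1 - ((4 * c) ^+ s.+1)^-1) ^+ j * deg (induced C) set0 < eps ->
  exists CC : {set {set V}},
  [/\ (#|CC| <= N.+1 ^ (s * m * j))%N,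
      forall D : {set V}, D \in CC -> deg (induced D) set0 < eps
    & forall I : {set V}, independent w I -> I \subset C ->
        exists2 D : {set V}, D \in CC & I \subset D].
Proof.
have c0 : 1 <= c by rewrite /c -natrM ler1n.
have g0 : 0 <= 1 - ((4 * c) ^+ s.+1)^-1.
  have : 1 <= (4 * c) ^+ s.+1 by apply: exprn_ege1; lra.
  by move=> h; rewrite subr_ge0 invf_le1 //; lra.
elim: j => [|j IH] C; first rewrite expr0 mul1r => eC.
  exists [set C]; split=> [|D|I _ IC]; first by rewrite cards1 muln0.
    by rewrite inE => /eqP->.
  by exists C; rewrite ?inE.
move=> eC; have [eps_le|lt_eps] := leP eps (deg (induced C) set0); last first.
  exists [set C]; split=> [|D|I _ IC]; first by rewrite cards1 expn_gt0.
    by rewrite inE => /eqP->.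
  by exists C; rewrite ?inE.
have [DD [cDD eDD iDD]] := container_shrink eps_le.
have /fin_all_exists[f hf] (D : {set V}) : exists CC : {set {set V}}, D \in DD ->
    [/\ (#|CC| <= N.+1 ^ (s * m * j))%N,
      forall D : {set V}, D \in CC -> deg (induced D) set0 < eps
    & forall I : {set V}, independent w I -> I \subset C :\: D ->
        exists2 D : {set V}, D \in CC & I \subset D].
  have [DDD|_] := boolP (D \in DD); last by exists set0.
  have [|CC hCC] := IH (C :\: D); last by exists CC.
  apply: le_lt_trans eC; rewrite [_ ^+ j.+1]exprSr -mulrA; apply: ler_wpM2l (eDD _ DDD).
  exact: exprn_ge0.
exists (\bigcup_(D in DD) f D); split.
- apply: (@leq_trans (\sum_(D in DD) N.+1 ^ (s * m * j))).
    by apply: leq_trans (card_bigcup_le _ _) _; apply: leq_sum => D /hf[].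
  by rewrite sum_nat_const mulnS expnD leq_mul2r cDD orbT.
- by move=> D /bigcupP[D' /hf[_ + _]]; exact.
- move=> I wI IC; have [D DDD dis] := iDD I wI.
  have [_ _ /(_ I wI)[|D' D'f ID']] := hf D DDD.
    by rewrite subsetD IC disjoint_sym.
  by exists D' => //; apply/bigcupP; exists D.
Qed.
End Containers.

(** * The hypergraph of k-cliques on the pairs *)

Section CliqueContainers.
Variables (k n : nat).

Definition clique_weight (E : {set pair_type n}) : rat :=
  #|[set h : {ffun 'I_k -> 'I_n} | injectiveb h && (pairs (h @: setT) == E)]|%:R.

Lemma clique_weight_ge0 E : 0 <= clique_weight E.
Proof. exact: ler0n. Qed.

Lemma clique_weight_neq0 E : clique_weight E != 0 ->
  exists2 h : {ffun 'I_k -> 'I_n}, injective h & pairs (h @: setT) = E.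
Proof.
rewrite pnatr_eq0 -lt0n => /card_gt0P[h]; rewrite inE => /andP[/injectiveP hi /eqP].
by exists h.
Qed.

Lemma uniform_clique_weight : uniform 'C(k, 2) clique_weight.
Proof.
move=> E /clique_weight_neq0[h hi <-].
by rewrite card_pairs card_imset // cardsT card_ord.
Qed.

Lemma sum_clique_weight (P : pred {set pair_type n}) :
  \sum_(E | P E) clique_weight E =
  #|[set h : {ffun 'I_k -> 'I_n} | injectiveb h && P (pairs (h @: setT))]|%:R.
Proof.
rewrite -[in RHS]sum1_card (partition_big (fun h : {ffun 'I_k -> 'I_n} => pairs (h @: setT)) P)
  /=; last first.
  by move=> h; rewrite inE => /andP[].
rewrite natr_sum; apply: eq_bigr => E PE; rewrite sum1_card; congr _%:R.
apply: eq_card => h; rewrite !inE unfold_in /= inE.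
by case: eqP => [->|]; rewrite ?PE ?andbT ?andbF.
Qed.

Lemma copies_induced C : deg (induced clique_weight C) set0 = #|copies k C|%:R.
Proof.
by rewrite deg_set0 /induced -big_mkcond /= sum_clique_weight.
Qed.

(** Take v to be the number of vertices spanned by S: a copy using all pairs of S has these v
    vertices in its image. *)
Lemma clique_codegree (S : {set pair_type n}) :
  exists v, (#|S| <= 'C(v, 2))%N /\ deg clique_weight S <= (if v <= k then k ^ v * n ^ (k - v)
    else 0)%N%:R.
Proof.
pose U := \bigcup_(e in S) val e; exists #|U|; split.
  rewrite -card_pairs; apply: subset_leq_card; apply/subsetP => e eS.
  by rewrite inE (bigcup_sup e).
rewrite /deg sum_clique_weight ler_nat.
have inU (h : {ffun 'I_k -> 'I_n}) : S \subset pairs (h @: setT) -> U \subset h @: setT.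
  by move=> sub; apply/bigcupsP => e /(subsetP sub); rewrite inE.
case: (leqP #|U| k) => [Uk|kU]; last first.
  rewrite leqn0 cards_eq0; apply/eqP/setP => h; rewrite !inE;
    apply/negP => /andP[_ /inU/subset_leq_card].
  rewrite leqNgt => /negP; apply; apply: leq_ltn_trans (leq_imset_card _ _) _.
  by rewrite cardsT card_ord.
have := card_image_sup 'I_k U; rewrite !card_ord; apply: leq_trans.
by apply: subset_leq_card; apply/subsetP => h; rewrite !inE => /andP[_ /inU].
Qed.

Lemma clique_containers (m s j : nat) (sigma eps : rat) :
  (0 < n)%N -> (0 < m)%N -> 0 < sigma -> 0 < eps -> 'C(k, 2) = s.+1 ->
  let c : rat := 2 * s.+1%:R in
  4 * (n ^ 2)%N%:R / m%:R * sigma * c ^+ s <= 2 * c ->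
  (forall v i, (3 <= v <= k)%N -> (1 < i <= 'C(v, 2))%N ->
     (k ^ v * n ^ (k - v))%N%:R <= sigma ^+ i.-1 * (eps / (2 * (n ^ 2)%N%:R))) ->
  (1 - ((4 * c) ^+ s.+1)^-1) ^+ j * (n ^ k)%N%:R < eps ->
  exists CC : {set {set pair_type n}},
  [/\ (#|CC| <= (n ^ 2).+1 ^ (s * m * j))%N,
      forall D, D \in CC -> #|copies k D|%:R < eps
    & forall I, copies k I = set0 -> exists2 D, D \in CC & I \subset D].
Proof.
move=> n0 m0 sigma0 eps0 ks c hc hcod hj.
have Vn : (#|{: pair_type n}| <= n ^ 2)%N.
  have h : (n * n.-1 <= n * n)%N by rewrite leq_mul2l leq_pred orbT.
  rewrite card_pair_type bin2 -mulnn; lia.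
have n20 : (0 < n ^ 2)%N by rewrite expn_gt0 n0.
have n2r : 0 < (n ^ 2)%N%:R :> rat by rewrite ltr0n.
have uw : uniform s.+1 clique_weight by rewrite -ks; exact: uniform_clique_weight.
have codeg (S : {set pair_type n}) : (1 < #|S|)%N ->
    deg clique_weight S <= sigma ^+ #|S|.-1 * (eps / (2 * (n ^ 2)%N%:R)).
  move=> S1; have [v [Sv]] := clique_codegree S.
  case: ifP => vk dS; apply: le_trans dS _.
    apply: hcod; rewrite ?S1 // vk andbT.
    by move: v Sv {vk} => [|[|[|//]]] //=; rewrite ?bin0n ?bin1 => /(leq_trans S1).
  by rewrite mulr_ge0 ?exprn_ge0 ?divr_ge0 ?mulr_ge0 // ltW.
have [|CC [cCC eCC iCC]] := container_family Vn n20 m0 sigma0 eps0 clique_weight_ge0 uw hc codeg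
  (j := j) (C := setT).
  apply: le_lt_trans hj; rewrite copies_induced; apply: ler_wpM2l.
    apply: exprn_ge0; rewrite subr_ge0 invf_le1 ?exprn_gt0 ?exprn_ege1 //;
      rewrite /c -?natrM ?ler1n ?ltr0n //.
  rewrite ler_nat; apply: leq_trans (max_card _) _; by rewrite card_ffun !card_ord.
exists CC; split=> // [D /eCC|I I0]; first by rewrite copies_induced.
apply: iCC => // E /clique_weight_neq0[h hi <-]; apply/negP => sub.
have : h \in copies k I by rewrite inE sub andbT; apply/injectiveP.
by rewrite I0 inE.
Qed.
End CliqueContainers.

Local Close Scope ring_scope.

(** * The random graph *)

Section EdgeGraph.
Variables (n : nat) (E : {set pair_type n}).

Definition edge_adj : rel 'I_n := fun x y => [exists e in E, val e == [set x; y]].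

Lemma edge_adj_sym : symmetric edge_adj.
Proof. by move=> x y; apply: eq_existsb => e; rewrite setUC. Qed.

Lemma edge_adj_irr : irreflexive edge_adj.
Proof.
move=> x; apply/existsP => -[e /andP[_ /eqP ev]].
by have := valP e; rewrite /= ev setUid cards1.
Qed.

Definition edge_graph : sgraph := SGraph edge_adj_sym edge_adj_irr.
End EdgeGraph.

Section RandomEdges.
Variables (k r R n M d b : nat) (CC : {set {set pair_type n}}).
Let N := #|{: pair_type n}|.
Let L := 'C(k.+1, 2).

(** Markov's inequality: the mean number of copies is at most n^(k+1) (M/N)^L, hence at most d/2. *)
Lemma few_cliques : 0 < n -> 0 < k -> L <= M -> 2 * n ^ k.+1 * M ^ L <= d * N ^ L ->
  2 * #|[set t : {ffun 'I_M -> pair_type n} | d < #|copies k.+1 (t @: setT)|]| <= N ^ M.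
Proof.
move=> n0 k0 LM hd; set Bad := [set t | _].
have [->|/set0Pn[t0 _]] := eqVneq Bad set0; first by rewrite cards0.
have h1 : #|Bad| * d <= \sum_(t : {ffun 'I_M -> pair_type n}) #|copies k.+1 (t @: setT)|.
  rewrite -sum_nat_const [X in _ <= X](bigID (mem Bad)) /=; apply: leq_trans (leq_addr _ _).
  by apply: leq_sum => t; rewrite inE => /ltnW.
have h2 : \sum_(t : {ffun 'I_M -> pair_type n}) #|copies k.+1 (t @: setT)| <=
    n ^ k.+1 * (M ^ L * N ^ (M - L)).
  under eq_bigr do rewrite -sum1dep_card big_mkcond.
  rewrite exchange_big /=.
  apply: (@leq_trans (\sum_(h : {ffun 'I_k.+1 -> 'I_n}) M ^ L * N ^ (M - L))); last first.
    by rewrite sum_nat_const card_ffun !card_ord.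
  apply: leq_sum => h _; have [hi|hi] := boolP (injectiveb h); last by rewrite big1.
  rewrite -big_mkcond sum1dep_card; apply: leq_trans (card_image_sup _ _) _.
  by rewrite card_pairs card_imset ?cardsT ?card_ord //; exact/injectiveP.
have NL : N ^ M = N ^ L * N ^ (M - L) by rewrite -expnD subnKC.
have M0 : 0 < M by apply: leq_trans LM; rewrite bin_gt0.
have Y0 : 0 < n ^ k.+1 * M ^ L by rewrite muln_gt0 !expn_gt0 n0 M0.
rewrite -(leq_pmul2l Y0).
have -> : n ^ k.+1 * M ^ L * (2 * #|Bad|) = #|Bad| * (2 * n ^ k.+1 * M ^ L) by ring.
have h3 := leq_mul (leqnn #|Bad|) hd.
have h4 := leq_mul (leq_trans h1 h2) (leqnn (N ^ L)).
apply: (leq_trans h3); rewrite mulnA; apply: (leq_trans h4); rewrite NL.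
by apply: eq_leq; rewrite !mulnA -!mulnA [N ^ (M - L) * _]mulnC.
Qed.

(** Union bound over the d possible deletions and the r containers: the latter miss b + d pairs, the
    former restore at most d, so N - b values remain for each entry of the tuple. *)
Lemma few_covered : (forall c : {ffun 'I_r -> {set pair_type n}}, (forall a, c a \in CC) ->
    b + d <= #|~: \bigcup_a c a|) ->
  #|[set t : {ffun 'I_M -> pair_type n} |
     [exists g : {ffun 'I_d -> pair_type n}, exists c : {ffun 'I_r -> {set pair_type n}},
       (c \in ffun_on (mem CC)) && (t @: setT \subset g @: setT :|: \bigcup_a c a)]]|
  <= N ^ d * #|CC| ^ r * (N - b) ^ M.
Proof.
move=> hb.
apply: (@leq_trans (\sum_(g : {ffun 'I_d -> pair_type n})
  \sum_(c : {ffun 'I_r -> {set pair_type n}} | c \in ffun_on (mem CC)) (N - b) ^ M)); last first.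
  by rewrite !sum_nat_const card_ffun_on card_ffun !card_ord mulnA.
apply: (@leq_trans (\sum_(g : {ffun 'I_d -> pair_type n})
  \sum_(c : {ffun 'I_r -> {set pair_type n}} | c \in ffun_on (mem CC))
   #|[set t : {ffun 'I_M -> pair_type n} | t @: setT \subset g @: setT :|: \bigcup_a c a]|)).
  rewrite pair_big_dep /=; apply: card_sum_le => t;
    rewrite inE => /existsP[g /existsP[c /andP[cC sub]]].
  by exists (g, c); rewrite ?inE.
apply: leq_sum => g _; apply: leq_sum => c /ffun_onP cC.
set W := _ :|: _; have cW : #|W| <= N - b.
  have h1 : #|g @: setT| <= d by apply: leq_trans (leq_imset_card _ _) _; rewrite cardsT card_ord.
  have h2 : #|W| <= #|g @: setT| + #|\bigcup_a c a| by case: (leq_card_setU (g @: setT)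
    (\bigcup_a c a)).
  have h3 : #|\bigcup_a c a| + #|~: \bigcup_a c a| = N := cardsC _.
  have h4 := hb c cC.
  move: h1 h2 h3 h4; move: #|W| #|_ @: _| #|\bigcup_a c a| #|~: _| N; lia.
apply: (@leq_trans (#|W| ^ M)); last by have [->|M0] := posnP M; rewrite ?expn0 ?leq_exp2r.
rewrite -[X in _ ^ X]card_ord -card_ffun_on; apply: subset_leq_card; apply/subsetP => t.
rewrite inE => /subsetP sub; apply/ffun_onP => i; apply: sub; exact: imset_f.
Qed.

(* The graph is a random M-tuple of pairs from which one edge of each K_{k+1}
   is deleted. If it failed to arrow, the color classes would lie in r
   containers, so the tuple would be covered by r containers and at most d
   deleted edges; the union bound excludes this. *)
Lemma folkman_of_containers : 0 < n -> 0 < k -> L <= M ->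
  2 * n ^ k.+1 * M ^ L <= d * N ^ L ->
  (forall c : {ffun 'I_r -> {set pair_type n}}, (forall a, c a \in CC) ->
    b + d <= #|~: \bigcup_a c a|) ->
  2 * (N ^ d * #|CC| ^ r * (N - b) ^ M) < N ^ M ->
  (forall I : {set pair_type n}, copies k I = set0 -> exists2 D, D \in CC & I \subset D) ->
  exists G : sgraph, is_folkman k r G /\ #|vertex G| = n.
Proof.
move=> n0 k0 LM hd hb hN cov.
have := few_cliques n0 k0 LM hd; have := few_covered hb.
set Bad2 := [set t | _]; set Bad1 := [set t | _] => c2 c1.
have [t tB] : exists t : {ffun 'I_M -> pair_type n}, t \notin Bad1 :|: Bad2.
  apply/existsP; apply: contraT => /existsPn h.
  have : #|Bad1 :|: Bad2| = N ^ M.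
    have -> : Bad1 :|: Bad2 = setT.
      by apply/setP => t; rewrite in_setT; exact: negbNE (h t).
    by rewrite cardsT card_ffun card_ord.
  have : #|Bad1 :|: Bad2| <= #|Bad1| + #|Bad2| by case: (leq_card_setU Bad1 Bad2).
  move: c1 c2 hN; move: #|Bad1 :|: Bad2| #|Bad1| #|Bad2|; lia.
have M0 : 0 < M by apply: leq_trans LM; rewrite bin_gt0.
have e0 : pair_type n := t (Ordinal M0).
move: tB; rewrite in_setU negb_or => /andP[]; rewrite inE -leqNgt => tX; rewrite inE => tC.
(* The edge deleted from a copy; the default is never reached, as k > 0 gives every copy an edge. *)
pose pe (h : {ffun 'I_k.+1 -> 'I_n}) := odflt e0 [pick e in pairs (h @: setT)].
pose D := [set pe h | h in copies k.+1 (t @: setT)].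
have Dd : #|D| <= d by apply: leq_trans (leq_imset_card _ _) tX.
pose E := (t @: setT) :\: D.
exists (edge_graph E); split; last by rewrite card_ord.
split=> [col|[f [fi fE]]]; last first.
  pose h := [ffun x => f x : 'I_n].
  have hi : injective h by move=> x y; rewrite !ffunE => /fi.
  have hE : pairs (h @: setT) \subset E.
    by apply/(pairs_subP _ hi) => x y xy; rewrite !ffunE; exact: fE.
  have hC : h \in copies k.+1 (t @: setT).
    rewrite inE; apply/andP; split; first exact/injectiveP.
    exact: subset_trans hE (subsetDl _ _).
  have peE : pe h \in pairs (h @: setT).
    rewrite /pe; case: pickP => //= none.
    have : #|pairs (h @: setT)| = 0 by apply: eq_card0.
    by move/eqP; rewrite card_pairs card_imset // cardsT card_ord eqn0Ngt bin_gt0 ltnS k0.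
  have := subsetP hE _ peE; rewrite inE => /andP[/negP[]]; exact: imset_f.
pose I (a : 'I_r) := [set e in E | col (val e) == a].
have [a ha|none] := pickP (fun a => copies k (I a) != set0).
  have /set0Pn[h] := ha; rewrite inE => /andP[/injectiveP hi /(pairs_subP _ hi) hI].
  exists a, h; split=> // x y xy.
  have /existsP[e /andP[]] := hI x y xy; rewrite inE => /andP[eE /eqP ce] /eqP ev.
  rewrite /= /class_adj /= -ev ce eqxx andbT; apply/existsP; exists e.
  by rewrite eE ev eqxx.
have /fin_all_exists2[c cC Ic] (a : 'I_r) : exists2 D, D \in CC & I a \subset D.
  by apply: cov; apply/eqP; move: (none a) => /negbFE.
(* The deleted edges are listed as a d-tuple, padded with [e0]. *)
case/existsP: tC; exists [ffun i : 'I_d => nth e0 (enum D) i]; apply/existsP; exists (finfun c).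
apply/andP; split; first by apply/ffun_onP => a; rewrite ffunE; exact: cC.
apply/subsetP => e et; rewrite inE.
have [eD|eD] := boolP (e \in D).
  apply/orP; left; apply/imsetP.
  have lt : index e (enum D) < d.
    by apply: leq_trans Dd; rewrite cardE index_mem mem_enum.
  by exists (Ordinal lt); rewrite // ffunE nth_index // mem_enum.
apply/orP; right; apply/bigcupP; exists (col (val e)) => //; rewrite ffunE.
by apply: (subsetP (Ic _)); rewrite !inE eD et eqxx.
Qed.
End RandomEdges.

(** * Choice of parameters *)

(** Bernoulli's inequality for 1 + b/x with denominators cleared. *)
Lemma bernoulli_expn x b J : (x + J * b) * x ^ J <= x * (x + b) ^ J.
Proof.
elim: J => [|J IH]; first by rewrite mul0n addn0.
have h : x ^ J <= (x + b) ^ J by case: J {IH} => // J; rewrite leq_exp2r // leq_addr.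
have h1 := leq_mul (leqnn x) IH; have h2 := leq_mul (leqnn (x * b)) h.
rewrite !expnS; nia.
Qed.

Lemma halving_expn N b J : 0 < J -> N <= J * b -> 2 * (N - b) ^ J <= N ^ J.
Proof.
move=> J0 NJ; have [Nb|bN] := leqP N b.
  by move: Nb; rewrite -subn_eq0 => /eqP->; rewrite exp0n // muln0.
have x0 : 0 < N - b by rewrite subn_gt0.
rewrite -(leq_pmul2l x0); have := bernoulli_expn (N - b) b J; rewrite subnK ?(ltnW bN) //.
apply: leq_trans; rewrite mulnCA mulnA leq_mul2r; apply/orP; right; lia.
Qed.

Lemma double_bin2 n : 2 * 'C(n.+1, 2) = n.+1 * n.
Proof. by rewrite -mul_bin_diag bin1. Qed.

(* With v = w + 2 and k = w + e + 2, this compares the exponents of u in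
   [codegree_bound]. *)
Lemma codegree_exponent w e i : 0 < w -> 2 * i <= w * (w + 3) ->
  (w + e + 3) + 36 * (w + e + 4) * i <= 2 * i + 18 * ((w + e + 3) * (w + e + 4)) * w.
Proof.
move=> w0 iw; set z := w + e + 4.
(* Only the largest i matters. There the main terms cancel, 2i pays for w + 3, and the surplus 18zwe
   pays for e. *)
have h1 : (18 * z - 1) * (2 * i) <= (18 * z - 1) * (w * (w + 3)) by rewrite leq_mul2l iw orbT.
have h2 : w + 3 <= w * (w + 3) by rewrite leq_pmull.
have h3 : e <= z * w * e by rewrite leq_pmull // muln_gt0 w0 /z addn4.
have -> : 18 * ((w + e + 3) * z) * w = 18 * (z * (w * (w + 3))) + 18 * (z * w * e) by ring.
move: h1; rewrite !mulnBl !mul1n.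
have -> : 18 * z * (2 * i) = 36 * z * i by ring.
have -> : 18 * z * (w * (w + 3)) = 18 * (z * (w * (w + 3))) by ring.
have h4 : w * (w + 3) <= z * (w * (w + 3)) by rewrite leq_pmull // /z addn4.
have h5 : 2 * i <= 36 * z * i by rewrite leq_mul2r /z; lia.
move: iw h2 h3 h4 h5; move: (z * (w * (w + 3))) (z * w * e) (36 * z * i) (w * (w + 3)); lia.
Qed.

Section Construction.
Variables (k r R : nat).
Hypotheses (k3 : 2 < k) (r2 : 1 < r) (rR : r < R).

(* With n = q^((k+1)(k+2)), the Ramsey threshold n^(-2/(k+1)) and the threshold
   n^(-2/(k+2)) at which the K_{k+1} become as frequent as edges are q^(-2(k+2))
   and q^(-2(k+1)). The gap q^2 = u^36 absorbs all constants, each of which is a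
   small power of u. The density of the random graph is about M/n^2, and m, j,
   g, d, b are the number of choices per container level, the number of
   iterations, the inverse of the shrinking rate, the number of deleted edges
   and a lower bound for the number of pairs missed after the deletion. *)
Definition u := k ^ (10 * k ^ 2) * R.
Definition q := u ^ 18.
Definition n := q ^ (k.+1 * k.+2).
Definition ell := 'C(k, 2).
Definition s := ell.-1.
Definition Q := q ^ (2 * k * k.+2).
Definition m := u ^ 3 * Q.
Definition g := (8 * ell) ^ ell.
Definition j := g * (R * k.+2).
Definition M := u ^ 20 * Q.
Definition L := 'C(k.+1, 2).
Definition d := 2 * 4 ^ L * u ^ (20 * L) * n.
Definition b := n ^ 2 %/ (16 * R ^ 2).
Definition N := #|{: pair_type n}|.

Lemma kX e : e <= 10 * k ^ 2 -> k ^ e <= k ^ (10 * k ^ 2).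
Proof. by move=> h; rewrite leq_exp2l //; lia. Qed.

Lemma X_le_u : k ^ (10 * k ^ 2) <= u.
Proof. by rewrite /u leq_pmulr //; apply: leq_ltn_trans rR. Qed.

Lemma R_le_u : R <= u.
Proof. by rewrite /u leq_pmull // expn_gt0 (ltn_trans _ k3). Qed.

Lemma ell_double : 2 * ell = k * k.-1.
Proof. by rewrite /ell; case: k k3 => // k' _; rewrite double_bin2. Qed.

Lemma L_double : 2 * L = k.+1 * k.
Proof. exact: double_bin2. Qed.

Lemma ell_gt2 : 2 < ell.
Proof.
have h : 2 * 3 <= 2 * ell by rewrite ell_double mulnC leq_mul //; lia.
by rewrite leq_pmul2l in h.
Qed.

Lemma u_gt1 : 1 < u.
Proof.
apply: leq_trans X_le_u; apply: (@leq_trans (k ^ 1)); first by rewrite expn1; lia.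
apply: kX; nia.
Qed.

Lemma k8_le_u : k ^ 8 <= u.
Proof. apply: leq_trans X_le_u; apply: kX; nia. Qed.

Lemma k4_ge : 81 <= k ^ 4.
Proof. by rewrite -[81]/(3 ^ 4) leq_exp2r. Qed.

(** The rate (8 ell)^ell, with [ell] quadratic in k, is what demands a power k^O(k^2) in [u]. *)
Lemma g_le_u : k * g <= u.
Proof.
apply: leq_trans X_le_u; apply: (@leq_trans (k ^ (1 + 4 * k ^ 2))); last by apply: kX; nia.
rewrite expnD expn1 leq_mul2l expnM; apply/orP; right.
have h1 : 8 * ell <= k ^ 4 by have := ell_double; rewrite !expnS expn0; nia.
apply: (@leq_trans ((k ^ 4) ^ ell)); first by rewrite leq_exp2r //; have := ell_gt2; lia.
by rewrite leq_exp2l; have := ell_double; have := k4_ge; nia.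
Qed.

(** Q / n = u^(18(k-1)(k+2)), whereas d / n is at most u^(21L+1) with L = k(k+1)/2. *)
Lemma d_le_Q : u ^ 2 * d <= Q.
Proof.
have u1 := u_gt1; have h4 : 4 ^ L <= u ^ L.
  rewrite leq_exp2r; last by have := L_double; nia.
  by apply: leq_trans k8_le_u; rewrite (leq_trans (_ : 4 <= 2 ^ 8)) // leq_exp2r //; lia.
apply: (@leq_trans (u ^ 2 * (u ^ 1 * u ^ L * u ^ (20 * L) * n))).
  rewrite leq_mul2l !leq_mul // ?orbT // expn1.
rewrite /n /Q /q -!expnM -!expnD leq_exp2l //.
have := L_double; nia.
Qed.

Lemma u_gt0 : 0 < u.
Proof. exact: ltnW u_gt1. Qed.

Lemma q_gt0 : 0 < q.
Proof. by rewrite /q expn_gt0 u_gt0. Qed.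

Lemma n_gt0 : 0 < n.
Proof. by rewrite /n expn_gt0 q_gt0. Qed.

Lemma square_n : n ^ 2 = Q * q ^ (2 * k.+2).
Proof. by rewrite /n /Q -expnM -expnD; congr (q ^ _); ring. Qed.

Lemma R2_le : 32 * R ^ 2 <= u ^ 2.
Proof.
have h : 81 <= k ^ (10 * k ^ 2) by apply: leq_trans k4_ge _; apply: kX; nia.
rewrite /u expnMn leq_mul2r; apply/orP; right.
apply: leq_trans (leq_trans (_ : 32 <= 81) h) _ => //.
by rewrite -[X in X <= _]expn1 leq_exp2l //; exact: leq_trans h.
Qed.

(** The codegree hypothesis of [clique_containers] with denominators cleared. Once the constants are
    bounded by u^(k+1), only exponents of u are compared. *)
Lemma codegree_bound v i : 2 < v <= k -> 1 < i <= 'C(v, 2) ->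
  4 * r * R ^ k * k ^ v * q ^ (2 * k.+2 * i.-1) * n ^ (k - v + 2) <= u ^ (2 * i.-1) * n ^ k.
Proof.
move=> /andP[v3 vk] /andP[i1 iv].
have h1 : 4 * r * R ^ k * k ^ v <= u ^ k.+1.
  have e1 : u ^ k.+1 = (k ^ (10 * k ^ 2)) ^ k.+1 * (R ^ k * R) by rewrite /u expnMn [R ^
    k.+1]expnSr.
  rewrite e1; have -> : 4 * r * R ^ k * k ^ v = 4 * k ^ v * (R ^ k * r) by ring.
  apply: leq_mul; last by rewrite leq_mul2l (ltnW rR) orbT.
  apply: (@leq_trans (k ^ (4 + k))).
    rewrite expnD; apply: leq_mul; first by have := k4_ge; lia.
    by rewrite leq_exp2l //; lia.
  by rewrite -expnM leq_exp2l; nia.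
apply: (@leq_trans (u ^ k.+1 * q ^ (2 * k.+2 * i.-1) * n ^ (k - v + 2))).
  by rewrite !leq_mul.
rewrite /n /q -!expnM -!expnD leq_exp2l ?u_gt1 //.
have [w vw] : exists w, v = w.+2 by exists v.-2; rewrite !prednK //; lia.
have [e ke] : exists e, k = w + 2 + e by exists (k - v); rewrite vw in vk *; lia.
have iw : 2 * i.-1 <= w * (w + 3).
  have := double_bin2 w.+1; rewrite vw in iv.
  have -> : w.+2 * w.+1 = w * (w + 3) + 2 by ring.
  lia.
have w0 : 0 < w by rewrite vw in v3.
have := codegree_exponent e w0 iw.
have -> : w + e + 3 = k.+1 by rewrite ke; lia.
have -> : w + e + 4 = k.+2 by rewrite ke; lia.
have -> : k - v + 2 = e + 2 by rewrite vw ke; lia.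
have ek : k.+1 * k.+2 * k = k.+1 * k.+2 * (e + 2) + k.+1 * k.+2 * w.
  by rewrite -mulnDr; congr (_ * _); rewrite ke; lia.
have -> : 18 * (k.+1 * k.+2 * k) = 18 * (k.+1 * k.+2 * (e + 2)) + 18 * (k.+1 * k.+2) * w.
  by rewrite ek; ring.
have -> : 18 * (2 * k.+2 * i.-1) = 36 * k.+2 * i.-1 by ring.
move: (18 * (k.+1 * k.+2) * w) (36 * k.+2 * i.-1) (18 * (k.+1 * k.+2 * (e + 2))); lia.
Qed.

(** Since [g] rounds halve the number of copies, the R(k+2) halvings in [j] suffice. *)
Lemma ramsey_power_lt : 2 * r * R ^ k < 2 ^ (R * k.+2).
Proof.
rewrite expnM; apply: (@leq_ltn_trans (R ^ k.+2)).
  have -> : R ^ k.+2 = R * R * R ^ k by rewrite !expnS mulnA.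
  rewrite leq_mul2r; apply/orP; right.
  by apply: leq_mul; [exact: leq_trans r2 (ltnW rR) | exact: ltnW].
by rewrite ltn_exp2r // ltn_expl.
Qed.

Lemma sS : s.+1 = ell.
Proof. by rewrite /s prednK //; apply: leq_trans ell_gt2. Qed.

Lemma container_base_bound : 2 * (2 * ell) ^ s <= u.
Proof.
apply: leq_trans g_le_u; rewrite /g -sS; apply: leq_mul; first exact: ltnW.
apply: (@leq_trans ((8 * s.+1) ^ s)); last by rewrite leq_pexp2l ?muln_gt0.
by case: (s) => // s'; rewrite leq_exp2r // leq_mul2r.
Qed.

Local Open Scope ring_scope.

Lemma contraction_bound (x : rat) (t : nat) : x = 1 - (g%:R)^-1 -> x ^+ (g * t) <= (2 ^ t)%N%:R^-1.
Proof.
move=> ->; have g0 : (0 < g)%N by rewrite /g expn_gt0 muln_gt0 /= (leq_trans _ ell_gt2).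
have gr : 0 < g%:R :> rat by rewrite ltr0n.
have -> : 1 - (g%:R)^-1 = (g - 1)%N%:R / g%:R :> rat.
  by rewrite natrB //; field; rewrite gt_eqF.
have h : (((g - 1)%N%:R / g%:R) ^+ g : rat) <= 2^-1.
  rewrite expr_div_n ler_pdivrMr ?exprn_gt0 // mulrC ler_pdivlMr // mulrC.
  by rewrite -!natrX -natrM ler_nat; apply: halving_expn; rewrite ?muln1.
rewrite exprM natrX -exprVn lerXn2r ?nnegrE ?exprn_ge0 ?divr_ge0 ?invr_ge0 ?ler0n //.
Qed.

Lemma clique_containers_exist : exists CC : {set {set pair_type n}},
  [/\ (#|CC| <= (n ^ 2).+1 ^ (s * m * j))%N,
      forall D, D \in CC -> (#|copies k D| * (2 * r * R ^ k) <= n ^ k)%N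
    & forall I, copies k I = set0 -> exists2 D, D \in CC & I \subset D].
Proof.
have u0 : 0 < u%:R :> rat by rewrite ltr0n u_gt0.
have q0 e : 0 < (q ^ e)%N%:R :> rat by rewrite ltr0n expn_gt0 q_gt0.
have n0 e : 0 < (n ^ e)%N%:R :> rat by rewrite ltr0n expn_gt0 n_gt0.
have m0 : (0 < m)%N by rewrite /m /Q muln_gt0 !expn_gt0 u_gt0.
have R0 : (0 < R)%N by apply: leq_ltn_trans rR.
have w0 : 0 < (2 * r * R ^ k)%N%:R :> rat.
  by rewrite ltr0n !muln_gt0 expn_gt0 R0 (ltnW r2).
(* The threshold n^(-2/(k+1)) times u^2; the factor u^3 in [m] then makes 4 n^2 sigma / m equal to
   4/u. *)
pose sigma : rat := (u ^ 2)%N%:R / (q ^ (2 * k.+2))%N%:R.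
pose eps : rat := (n ^ k)%N%:R / (2 * r * R ^ k)%N%:R.
have sigma0 : 0 < sigma by rewrite divr_gt0 // ltr0n expn_gt0 u_gt0.
have eps0 : 0 < eps by rewrite divr_gt0.
have cE : 2 * s.+1%:R = (2 * ell)%N%:R :> rat by rewrite sS natrM.
have [|||CC [cCC eCC iCC]] := clique_containers (j := j) n_gt0 m0 sigma0 eps0 (esym sS).
- rewrite cE square_n /m /sigma.
  have -> : 4 * (Q * q ^ (2 * k.+2))%N%:R / (u ^ 3 * Q)%N%:R *
     ((u ^ 2)%N%:R / (q ^ (2 * k.+2))%N%:R) = 4 / u%:R :> rat.
    have Q0 : Q%:R != 0 :> rat by rewrite gt_eqF // q0.
    have Y0 : (q ^ (2 * k.+2))%N%:R != 0 :> rat by rewrite gt_eqF.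
    rewrite (natrM _ Q) (natrM _ (u ^ 3)) (natrX _ u 3) (natrX _ u 2);
      move: Q%:R (q ^ _)%N%:R u%:R Q0 Y0 (lt0r_neq0 u0) => a y x a0 y0 x0.
    by field; rewrite a0 y0 x0.
  rewrite mulrAC ler_pdivrMr // -natrX -!natrM ler_nat.
  have := container_base_bound; have := ell_gt2; nia.
- move=> v i vk iv; have := codegree_bound vk iv.
  have -> : sigma ^+ i.-1 = (u ^ (2 * i.-1))%N%:R / (q ^ (2 * k.+2 * i.-1))%N%:R.
    by rewrite /sigma expr_div_n -!natrX (expnM u 2) (expnM q (2 * k.+2)).
  rewrite /eps.
  have -> : (u ^ (2 * i.-1))%N%:R / (q ^ (2 * k.+2 * i.-1))%N%:R *
     ((n ^ k)%N%:R / (2 * r * R ^ k)%N%:R / (2 * (n ^ 2)%N%:R)) =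
     (u ^ (2 * i.-1) * n ^ k)%N%:R /
     (q ^ (2 * k.+2 * i.-1) * (2 * r * R ^ k) * (2 * n ^ 2))%N%:R :> rat.
    rewrite !(natrM _ (_ * _) (2 * n ^ 2)) (natrM _ (q ^ _)) (natrM _ (u ^ _)) (natrM _ 2).
    move: (lt0r_neq0 (q0 (2 * k.+2 * i.-1)%N)) (lt0r_neq0 (n0 2)) (lt0r_neq0 w0).
    move: (q ^ _)%N%:R (n ^ 2)%N%:R (2 * r * R ^ k)%N%:R => x y z x0 y0 z0.
    by field; rewrite x0 y0 z0.
  rewrite ler_pdivlMr; last first.
    by rewrite (natrM _ (_ * _) (2 * n ^ 2)) (natrM _ (q ^ _)) (natrM _ 2) !mulr_gt0.
  rewrite -natrM ler_nat; apply: leq_trans; apply: eq_leq.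
  by rewrite expnD; ring.
- rewrite cE; apply: le_lt_trans (ler_wpM2r (ler0n _ _) (@contraction_bound _ (R * k.+2) _)) _.
    by rewrite -natrM -natrX sS mulnA.
  rewrite /eps mulrC ltr_pM2l //.
  have h : (2 * r * R ^ k)%N%:R < (2 ^ (R * k.+2))%N%:R :> rat by rewrite ltr_nat ramsey_power_lt.
  by rewrite ltf_pV2 // posrE // (lt_trans w0 h).
exists CC; split=> // D /eCC.
by rewrite ltr_pdivlMr // -natrM ltr_nat => /ltnW.
Qed.

Local Close Scope ring_scope.

Lemma pow_u_le x y : x <= y -> u ^ x <= u ^ y.
Proof. by move=> h; rewrite leq_exp2l // u_gt1. Qed.

Lemma Q_gt0 : 0 < Q.
Proof. by rewrite /Q expn_gt0 q_gt0. Qed.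

Lemma Q_le_n2 : Q <= n ^ 2.
Proof. by rewrite square_n leq_pmulr // expn_gt0 q_gt0. Qed.

Lemma u2_le_n : u ^ 2 <= n.
Proof. by rewrite /n /q -expnM; apply: pow_u_le; nia. Qed.

Lemma k_poly_le_u : 36 * (k.+1 * k.+2) <= u.
Proof.
apply: leq_trans k8_le_u; rewrite (expnD k 4 4); apply: leq_mul.
  by apply: leq_trans k4_ge.
by rewrite (expnD k 2 2); apply: leq_mul; rewrite -mulnn; nia.
Qed.

Lemma R_k_le_u : R * k.+2 <= u.
Proof.
rewrite mulnC /u leq_mul2r; apply/orP; right.
by apply: (@leq_trans (k ^ 2)); [rewrite -mulnn; nia | apply: kX; nia].
Qed.

Lemma s_le_u : s <= u.
Proof.
apply: (@leq_trans (36 * (k.+1 * k.+2))); last exact: k_poly_le_u.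
have := ell_double; have := sS; have : k * k.-1 <= k.+1 * k.+2 by apply: leq_mul; lia.
lia.
Qed.

Lemma L_le_M : L <= M.
Proof.
apply: (@leq_trans u).
  apply: leq_trans k_poly_le_u; have := L_double.
  have : k.+1 * k <= k.+1 * k.+2 by apply: leq_mul; lia.
  lia.
rewrite /M -[X in X <= _]muln1 leq_mul ?Q_gt0 //.
by rewrite -[X in X <= _]expn1; apply: pow_u_le.
Qed.

Lemma d_le : 16 * R ^ 2 * d <= n ^ 2.
Proof.
apply: leq_trans Q_le_n2; apply: leq_trans d_le_Q; rewrite leq_mul2r; apply/orP; right.
by apply: leq_trans R2_le; rewrite leq_mul2r orbT.
Qed.

Lemma R2_le_n : 4 * R ^ 2 <= n.
Proof.
apply: leq_trans u2_le_n; apply: leq_trans R2_le; by rewrite leq_mul2r orbT.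
Qed.

Lemma b_le : b * (16 * R ^ 2) <= n ^ 2.
Proof. exact: leq_divM. Qed.

Lemma N_double : 2 * N = n * n.-1.
Proof. by rewrite /N card_pair_type -mul_bin_diag bin1. Qed.

Lemma n_gt1 : 1 < n.
Proof. by apply: leq_trans u2_le_n; rewrite (leq_trans u_gt1) // -[X in X <= _]expn1 pow_u_le. Qed.

Lemma N_ge : n ^ 2 <= 4 * N.
Proof.
rewrite -[4]/(2 * 2) -mulnA N_double -mulnn mulnCA leq_mul2l; have := n_gt1; lia.
Qed.

Lemma N_le : N <= n ^ 2.
Proof.
have h : n * n.-1 <= n * n by rewrite leq_mul2l leq_pred orbT.
have := N_double; rewrite -mulnn; lia.
Qed.

Lemma N_le_b : N <= 32 * R ^ 2 * b.
Proof.
apply: leq_trans N_le _.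
have R0 : 0 < 16 * R ^ 2 by rewrite muln_gt0 expn_gt0 (leq_ltn_trans _ rR).
have b0 : 0 < b.
  rewrite /b divn_gt0 //; apply: leq_trans Q_le_n2; apply: leq_trans d_le_Q.
  apply: (@leq_trans (u ^ 2)); first by apply: leq_trans R2_le; rewrite leq_mul2r orbT.
  rewrite leq_pmulr // /d muln_gt0 n_gt0 andbT muln_gt0.
  by rewrite [0 < u ^ _]expn_gt0 u_gt0 andbT muln_gt0 expn_gt0.
apply: leq_trans (ltnW (ltn_ceil (n ^ 2) R0)) _; rewrite -/b.
have -> : 32 * R ^ 2 * b = (b + b) * (16 * R ^ 2) by ring.
by rewrite leq_mul2r; apply/orP; right; rewrite -addn1 leq_add2l.
Qed.

Lemma n_lt_pow : (n ^ 2).+1 <= 2 ^ (36 * (k.+1 * k.+2) * u).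
Proof.
have h : n < 2 ^ (18 * (k.+1 * k.+2) * u).
  have e1 : n = u ^ (18 * (k.+1 * k.+2)) by rewrite /n /q -expnM.
  have pos : 0 < 18 * (k.+1 * k.+2) by rewrite !muln_gt0.
  by rewrite e1 [18 * _ * u]mulnC (expnM 2) (ltn_exp2r u (2 ^ u) pos) (ltn_expl u (ltnSn 1)).
have -> : 36 * (k.+1 * k.+2) * u = 18 * (k.+1 * k.+2) * u * 2 by ring.
by rewrite (expnM 2) (ltn_exp2r n (2 ^ _) (ltn0Sn 1)).
Qed.

(** The parenthesis is the logarithm of the number of cases in the union bound, plus 2; every 32 R^2
    entries of the tuple halve the chance of being covered. The left side is at most u^13 Q. *)
Lemma exponent_le : 32 * R ^ 2 * (36 * (k.+1 * k.+2) * u * (d + s * m * j * r) + 2) <= M.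
Proof.
have u0 := u_gt0; have Q0 := Q_gt0.
have u2 : 2 <= u := u_gt1.
have ru : r <= u by apply: leq_trans (ltnW rR) R_le_u.
have gu : g <= u by apply: leq_trans g_le_u; rewrite leq_pmull //; lia.
have ju : j <= u * u by rewrite leq_mul // R_k_le_u.
have dQ : d <= u ^ 7 * Q.
  apply: leq_trans (leq_pmull _ _) => //; last by rewrite expn_gt0 u0.
  by apply: leq_trans d_le_Q; rewrite leq_pmull // expn_gt0 u0.
have smjr : s * m * j * r <= u ^ 7 * Q.
  have -> : u ^ 7 * Q = u * (u ^ 3 * Q) * (u * u) * u by ring.
  exact: leq_mul (leq_mul (leq_mul s_le_u (leqnn m)) ju) ru.
have h1 : d + s * m * j * r <= u ^ 8 * Q.
  apply: (@leq_trans (u * (u ^ 7 * Q))); last by rewrite mulnA -expnS.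
  by apply: leq_trans (leq_mul u2 (leqnn _)); rewrite mul2n -addnn leq_add.
have h2 : 36 * (k.+1 * k.+2) * u * (d + s * m * j * r) <= u ^ 10 * Q.
  have -> : u ^ 10 * Q = u * u * (u ^ 8 * Q) by ring.
  exact: leq_mul (leq_mul k_poly_le_u (leqnn u)) h1.
have h3 : 2 <= u ^ 10 * Q.
  apply: leq_trans u2 _; rewrite -[X in X <= _]muln1 leq_mul //.
  by rewrite -[X in X <= _]expn1 pow_u_le.
have h4 : 36 * (k.+1 * k.+2) * u * (d + s * m * j * r) + 2 <= u * (u ^ 10 * Q).
  by apply: leq_trans (leq_mul u2 (leqnn _)); rewrite mul2n -addnn leq_add.
apply: leq_trans (leq_mul R2_le h4) _.
have -> : u ^ 2 * (u * (u ^ 10 * Q)) = u ^ 13 * Q by ring.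
by rewrite /M leq_mul2r pow_u_le ?orbT.
Qed.

(** The identity n^k Q^L = n^(2L) leaves a mean of order n; [d] adds u^(20L) from M, 4^L from N >=
    n^2 / 4 and Markov's 2. *)
Lemma clique_expectation_le : 2 * n ^ k.+1 * M ^ L <= d * N ^ L.
Proof.
have h : n ^ k * Q ^ L <= n ^ (2 * L).
  have e1 x : n ^ x = q ^ (k.+1 * k.+2 * x) by rewrite /n -expnM.
  have e2 : Q ^ L = q ^ (2 * k * k.+2 * L) by rewrite /Q -expnM.
  rewrite !e1 e2 -expnD L_double.
  have -> : 2 * k * k.+2 * L = k * k.+2 * (2 * L) by ring.
  by rewrite L_double; apply: eq_leq; congr (q ^ _); ring.
have h2 : n ^ (2 * L) <= 4 ^ L * N ^ L.
  by rewrite expnM -expnMn; case: (L) => // L'; rewrite leq_exp2r // N_ge.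
have -> : 2 * n ^ k.+1 * M ^ L = 2 * u ^ (20 * L) * n * (n ^ k * Q ^ L).
  by rewrite /M expnMn -expnM expnS; ring.
have -> : d * N ^ L = 2 * u ^ (20 * L) * n * (4 ^ L * N ^ L) by rewrite /d; ring.
by rewrite leq_mul2l (leq_trans h h2) orbT.
Qed.

Lemma folkman_exists : arrows (complete R) (complete k) r ->
  exists G : sgraph, is_folkman k r G /\ #|vertex G| = n.
Proof.
move=> hR; have [CC [cCC eCC iCC]] := clique_containers_exist.
have R0 : 0 < 16 * R ^ 2 by rewrite muln_gt0 expn_gt0 (leq_ltn_trans _ rR).
have k0 : 0 < k by apply: leq_trans k3.
apply: (folkman_of_containers (M := M) (d := d) (b := b)
  n_gt0 k0 L_le_M clique_expectation_le _ _ iCC).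
(* The n^2 / (8 R^2) missed pairs are split evenly between b and d. *)
- move=> c cC; have := supersaturation hR (ltnW r2) (leq_trans r2 (ltnW rR)) R2_le_n (fun a =>
  eCC _ (cC a)).
  have := b_le; have := d_le => h1 h2 h3; rewrite -(leq_pmul2l R0).
  move: h1 h2 h3; set x := #|~: _|; move: (n ^ 2) (R ^ 2) => y z; lia.
(* Of the final 2, one unit pays for the factor 2 in the goal, the other makes the inequality
   strict. *)
set A := 36 * (k.+1 * k.+2) * u; pose e := A * (d + s * m * j * r) + 2.
set J := 32 * R ^ 2.
have J0 : 0 < J by rewrite muln_gt0 expn_gt0 (leq_ltn_trans _ rR).
have N0 : 0 < N.
  have n2 : 0 < n ^ 2 by rewrite expn_gt0 n_gt0.
  by have := leq_trans n2 N_ge; rewrite muln_gt0.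
have eM : J * e <= M := exponent_le.
have h1 : N ^ d * #|CC| ^ r <= 2 ^ (A * (d + s * m * j * r)).
  rewrite mulnDr expnD leq_mul //.
    rewrite (expnM 2); have [->|d0] := posnP d; rewrite ?expn0 // leq_exp2r //.
    exact: leq_trans N_le (leq_trans (leqnSn _) n_lt_pow).
  rewrite mulnA (expnM 2) leq_exp2r; last exact: ltnW.
  apply: leq_trans cCC _; rewrite (expnM 2); have [->|smj0] := posnP (s * m * j);
    rewrite ?expn0 // leq_exp2r //.
  exact: n_lt_pow.
have h2 : 2 ^ e * (N - b) ^ M <= N ^ M.
  have [w ->] : exists w, M = J * e + w by exists (M - J * e); rewrite subnKC.
  rewrite (expnD (N - b)) (expnD N) mulnA; apply: leq_mul.
    rewrite (expnM (N - b)) (expnM N) -expnMn leq_exp2r; last by rewrite /e addn2.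
    exact: halving_expn J0 N_le_b.
  by have [->|w0] := posnP w; rewrite ?expn0 // leq_exp2r // leq_subr.
have [->|x0] := posnP ((N - b) ^ M); first by rewrite !muln0 expn_gt0 N0.
apply: leq_trans h2; rewrite /e (expnD 2).
have y0 : 0 < 2 ^ (A * (d + s * m * j * r)) by rewrite expn_gt0.
move: h1 x0 y0; move: (2 ^ (A * _)) (N ^ d * _) ((N - b) ^ M) => y z x zy x0 y0.
have zx : z * x <= y * x by rewrite leq_mul2r zy orbT.
have yx : 0 < y * x by rewrite muln_gt0 y0 x0.
by rewrite -[y * _ * x]mulnAC mulnC; lia.
Qed.

(** n = u^(18(k+1)(k+2)), and 18(k+1)(k+2) <= 40k^2 with equality at k = 3; the 400 is 10 times
    40. *)
Lemma n_le : n <= k ^ (400 * k ^ 4) * R ^ (40 * k ^ 2).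
Proof.
have eE : 18 * (k.+1 * k.+2) <= 40 * k ^ 2.
  by rewrite -mulnn; case: k k3 => [|[|[|k']]] // _; nia.
have -> : n = k ^ (10 * k ^ 2 * (18 * (k.+1 * k.+2))) * R ^ (18 * (k.+1 * k.+2)).
  by rewrite /n /q -expnM /u expnMn -expnM.
apply: leq_mul; rewrite leq_pexp2l //; first exact: leq_trans k3.
  have -> : 400 * k ^ 4 = 10 * k ^ 2 * (40 * k ^ 2) by ring.
  by rewrite leq_mul2l eE orbT.
exact: leq_ltn_trans rR.
Qed.
End Construction.

(** * Least witnesses and the bounds in terms of k and r *)

Local Open Scope ring_scope.

Lemma least_exists (P : nat -> Prop) m : P m -> exists2 l, is_least P l & (l <= m)%N.
Proof.
move=> Pm; have ex : exists l, `[< P l >] by exists m; apply/asboolP.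
case: (ex_minnP ex) => l /asboolP Pl min_l.
exists l; last by apply: min_l; apply/asboolP.
by split=> // l' Pl'; apply: min_l; apply/asboolP.
Qed.

Theorem theorem1p1 (K : realType) :
  exists c : K, 0 < c /\
    forall r k : nat, (2 <= r)%N -> (3 <= k)%N ->
      exists R f : nat,
        is_ramsey_number k r R /\ is_folkman_number k r f /\
        (f%:R : K) <= k%:R ^+ (400 * k ^ 4)%N * R%:R ^+ (40 * k ^ 2)%N
             <= (2 : K) `^ (c * (k%:R ^+ 4 * log2 k%:R
                           + k%:R ^+ 3 * r%:R * log2 r%:R)).
Proof.
(* The constant 400 matches the power of k exactly; R <= r^(rk) gives the power of r with 40
   already. *)
exists 400; split=> // r k r2 k3.
have [R hR Rle] := least_exists (P := fun n => arrows (complete n) (complete k) r) (ramsey_upper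
  (k := k) r2).
have rR := ramsey_lower (ltnW r2) k3 hR.1.
have [f hf fle] := least_exists (P := fun n => exists G : sgraph, is_folkman k r G /\ #|vertex
  G| = n) (folkman_exists k3 r2 rR hR.1).
exists R, f; split=> //; split=> //; apply/andP; split.
  by rewrite -!natrX -natrM ler_nat (leq_trans fle) // (n_le k3 r2 rR).
have r0 : 0 < r%:R :> K by rewrite ltr0n ltnW.
have k0 : 0 < k%:R :> K by rewrite ltr0n (leq_trans _ k3).
have ln2 : ln 2 != 0 :> K by rewrite gt_eqF // ln_gt0 // ltr1n.
have -> : (2 : K) `^ (400 * (k%:R ^+ 4 * log2 k%:R + k%:R ^+ 3 * r%:R * log2 r%:R)) =
    k%:R ^+ (400 * k ^ 4)%N * r%:R ^+ (400 * k ^ 3 * r)%N.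
  rewrite /powR pnatr_eq0 /=.
  rewrite -[in RHS](lnK k0) -[X in _ = _ * X ^+ _](lnK r0) -!expRM_natl -expRD; congr expR.
  by rewrite /log2 (natrM _ 400 (k ^ 4)) (natrM _ (400 * k ^ 3)) (natrM _ 400 (k ^ 3)) (natrX _
    k 4) (natrX _ k 3); field.
rewrite ler_wpM2l ?exprn_ge0 ?ler0n //.
rewrite -!natrX ler_nat; apply: (@leq_trans ((r ^ (r * k)) ^ (40 * k ^ 2))%N).
  by rewrite leq_exp2r // muln_gt0 expn_gt0 (leq_trans _ k3).
rewrite -expnM leq_pexp2l ?(ltnW r2) //.
have -> : (r * k * (40 * k ^ 2) = 40 * k ^ 3 * r)%N by ring.
by apply: leq_mul => //; apply: leq_mul.
Qed.
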